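(* Let $n\ge2$, let $\Omega\subset\mathbb{R}^n$ be a bounded open set, let $U_0\subset\subset\Omega$ be open, and let $x_0\in\partial U_0$. Then there exists a sequence $f_k\in L^\infty(\Omega)$ converging to $0$ weakly in $H^{-1}(\Omega)$ such that, for the set functions $\nu'$, $\nu''$ associated with $f_k$ and with $A_k=I$ (the identity matrix) for every $k$ (as defined in the context), the following hold: (a) $\nu'(U)=\nu''(U)=0$ for every open set $U\subset\Omega$ such that $x_0\notin\overline U$; (b) $\nu'(U)=\nu''(U)=1$ for every open set $U\subset\Omega$ such that $x_0\in U$; (c) $\nu'(U_0)=\nu''(U_0)=1$. Conditions (a) and (b) imply that the collection $\mathcal{U}:=\{U\subset\Omega:\ U\text{ open},\ \nu'(U)=\nu''(U)\}$ is rich, hence the set function $$\nu(U)=\sup\{\nu'(V):V\text{ open},\,V\subset\subset U\}=\sup\{\nu''(V):V\text{ open},\,V\subset\subset U\},\qquad U\subset\Omega\text{ open},$$ is well defined (the two suprema coincide). Moreover, (d) $\nu=\delta_{x_0}$ (i.e. $\nu(U)=\delta_{x_0}(U)$ for every open $U\subset\Omega$). Finally, $\nu(U_0)=0<1=\nu''(U_0)=\nu'(U_0)$.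
   Context: $V\subset\subset U$ means that $\overline V$ is compact and contained in $U$. $\delta_{x_0}$ is the unit mass concentrated at $x_0$. For $U$ bounded open, $H^1_0(U)$ is normed by $\|u\|_{H^1_0(U)}=(\int_U|\nabla u|^2dx)^{1/2}$ and $H^{-1}(U)$ is its dual; a function $f\in L^\infty(\Omega)$ is identified with the element $v\mapsto\int_\Omega fv\,dx$ of $H^{-1}(\Omega)$. Functions in $H^1_0(U)$, $U\subset\Omega$ open, are extended by $0$ to $\Omega$. For $U\subset\Omega$ open and $v\in H^1_0(U)$ let (with $A_k=I$) $$F_k(v,U)=\frac12\int_U|\nabla v|^2dx-\int_Uf_kv\,dx,$$ and define $$-\nu'(U)=\inf_{v_k\in H^1_0(U),\,v_k\rightharpoonup0}\ \liminf_{k\to\infty}F_k(v_k,U),\qquad -\nu''(U)=\inf_{v_k\in H^1_0(U),\,v_k\rightharpoonup0}\ \limsup_{k\to\infty}F_k(v_k,U),$$ where the infima are over sequences converging to $0$ weakly in $H^1_0(U)$. A collection $\mathcal{R}$ of open subsets of $\Omega$ is rich if, for every family $(U_t)_{t\in(0,1)}$ of open subsets of $\Omega$ such that $t_1<t_2$ implies $U_{t_1}\subset\subset U_{t_2}$, the set $\{t\in(0,1):U_t\notin\mathcal{R}\}$ is at most countable. *)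

(* Defs.v *)
From HB Require Import structures.
From mathcomp Require Import all_boot all_order all_algebra.
From mathcomp Require Import all_classical all_reals all_analysis.
From mathcomp Require Import measurable_realfun.

Set Implicit Arguments.
Unset Strict Implicit.
Unset Printing Implicit Defensive.
Import Order.TTheory GRing.Theory Num.Theory.
Import numFieldNormedType.Exports.
Local Open Scope classical_set_scope.
Local Open Scope ring_scope.

(* The points of [R^n] are the row vectors ['rV[R]_n], which already carry the
   usual topology; they are given the Borel sigma-algebra. *)
Section borel_rV.
Context {R : realType} (n : nat).

HB.instance Definition _ := @isMeasurable.Build
  (sigma_display (@open 'rV[R]_n)) 'rV[R]_n <<s (@open 'rV[R]_n) >>
  (@sigma_algebra0 _ setT _) (@sigma_algebraC _ _)
  (@sigma_algebra_bigcup _ setT _).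

Lemma open_measurable_rV (U : set 'rV[R]_n) : open U -> measurable U.
Proof. by move=> oU; apply: sub_sigma_algebra. Qed.

Lemma rV_ballP (x y : 'rV[R]_n) e :
  ball x e y <-> 0 < e /\ forall i, `|x 0 i - y 0 i| < e.
Proof.
split=> [[e0 xy]|[e0 xy]]; split=> // i; first exact: (xy 0 i).
by move=> j; rewrite ord1; exact: xy.
Qed.

Let rat_ball (p : 'rV[rat]_n * nat) : set 'rV[R]_n :=
  ball (map_mx ratr p.1 : 'rV[R]_n) p.2.+1%:R^-1.

Lemma open_rV_bigcup (U : set 'rV[R]_n) : open U ->
  U = \bigcup_(p in [set p | rat_ball p `<=` U]) rat_ball p.
Proof.
move=> oU; apply/seteqP; split=> [x Ux|x [p /= pU]]; last exact: pU.
have /nbhs_ballP[e /= e0 xeU] : nbhs x U by exact: open_nbhs_nbhs.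
have [k ke] : exists k : nat, k.+1%:R^-1 < e / 2.
  have e20 : 0 < e / 2 by rewrite divr_gt0.
  exists (Num.truncn (e / 2)^-1).
  rewrite invf_plt ?posrE ?ltr0n//.
  by rewrite Num.Theory.truncnS_gt.
have k0 : 0 < k.+1%:R^-1 :> R by rewrite invr_gt0 ltr0n.
have /choice[q qE] (i : 'I_n) : exists q : rat, `|ratr q - x 0 i| < k.+1%:R^-1.
  have /rat_in_itvoo[q] : x 0 i - k.+1%:R^-1 < x 0 i + k.+1%:R^-1.
    by rewrite ltrBlDr -addrA ltrDl addr_gt0.
  by rewrite in_itv/= => qx; exists q; rewrite ltr_distl.
exists (\row_i q i, k) => /=.
  move=> y /rV_ballP[_ /= yq]; apply: xeU; apply/rV_ballP; split=> // i.
  have := yq i; rewrite !mxE => {}yq.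
  have := ler_distD (ratr (q i)) (x 0 i) (y 0 i).
  move=> /le_lt_trans; apply; rewrite (splitr e) ltrD//.
    by rewrite distrC (lt_trans (qE i)).
  exact: lt_trans ke.
by apply/rV_ballP; split=> //= i; rewrite !mxE.
Qed.

Lemma measurable_fun_rV d (T : measurableType d) (f : T -> 'rV[R]_n) :
  (forall i, measurable_fun setT (fun x => f x 0 i : R)) ->
  measurable_fun setT f.
Proof.
move=> mf.
apply: (@measurability _ _ _ _ setT f (@open 'rV[R]_n)) => //.
move=> _ [U oU <-]; rewrite setTI (open_rV_bigcup oU) preimage_bigcup.
rewrite bigcup_mkcond; apply: countable_bigcupT_measurable => // -[q k].
case: ifPn => // _.
have -> : f @^-1` rat_ball (q, k) =
    \bigcap_(i in [set: 'I_n])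
      ((fun x => f x 0 i) @^-1` ball (ratr (q 0 i) : R) k.+1%:R^-1).
  apply/seteqP; split=> [x /rV_ballP[_ /= xq] i _|x xq].
    by have := xq i; rewrite !mxE.
  apply/rV_ballP; split=> [|i]; first by rewrite invr_gt0 ltr0n.
  by rewrite !mxE; exact: xq.
apply: fin_bigcap_measurable => // i _.
by rewrite -[X in measurable X]setTI; apply: mf => //; rewrite ball_itv; exact: measurable_itv.
Qed.

Lemma measurable_coord (i : 'I_n) :
  measurable_fun setT (fun x : 'rV[R]_n => x 0 i : R).
Proof.
apply: (measurability _ (RGenOpens.measurableE R)).
move=> _ [_ [a [b ->] <-]]; rewrite setTI; apply: open_measurable_rV.
apply: open_comp; last exact: interval_open.
by move=> x _; exact: coord_continuous.
Qed.

End borel_rV.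

(* [R^(n+1)] is identified with [R * R^n] through [consr]. *)
Section lebesgue_rV.
Context {R : realType}.

Definition consr n (p : measurableTypeR R * 'rV[R]_n) : 'rV[R]_n.+1 :=
  row_mx (p.1 : R)%:M p.2.

Lemma consr0 n p : @consr n p 0 ord0 = p.1.
Proof.
have -> : ord0 = lshift n (ord0 : 'I_1) by exact: val_inj.
by rewrite [LHS](row_mxEl (p.1 : R)%:M p.2) mxE eqxx mulr1n.
Qed.

Lemma consr_lift n p i : @consr n p 0 (lift ord0 i) = p.2 0 i.
Proof.
have -> : lift ord0 i = rshift 1 i by exact: val_inj.
exact: (row_mxEr (p.1 : R)%:M p.2).
Qed.

Lemma measurable_consr n : measurable_fun setT (@consr n).
Proof.
apply: measurable_fun_rV => i; case: (unliftP ord0 i) => [j|] ->.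
  under eq_fun do rewrite consr_lift.
  apply: (measurableT_comp (f := fun x : 'rV[R]_n => x 0 j : R)) => //.
  exact: measurable_coord.
under eq_fun do rewrite consr0.
exact: measurable_fst.
Qed.

Section step.
Variables (n : nat) (m : {sigma_finite_measure set 'rV[R]_n -> \bar R}).

Definition lebesgue_step : set 'rV[R]_n.+1 -> \bar R :=
  pushforward (@lebesgue_measure R \x m)%E (@consr n).

Let mc := @measurable_consr n.

Let step0 : lebesgue_step set0 = 0%E.
Proof. by rewrite /lebesgue_step; exact: measure0. Qed.

Let step_ge0 A : (0 <= lebesgue_step A)%E.
Proof. by rewrite /lebesgue_step; exact: measure_ge0. Qed.

Let step_sigma_additive : semi_sigma_additive lebesgue_step.
Proof. by rewrite /lebesgue_step; exact: measure_semi_sigma_additive. Qed.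

HB.instance Definition _ := isMeasure.Build _ _ _ lebesgue_step
  step0 step_ge0 step_sigma_additive.

Let unconsr (x : 'rV[R]_n.+1) : measurableTypeR R * 'rV[R]_n :=
  (x 0 ord0, \row_i x 0 (lift ord0 i)).

Let consrK p : unconsr (consr p) = p.
Proof.
case: p => t x; rewrite /unconsr consr0/=; congr pair.
by apply/rowP => i; rewrite mxE consr_lift.
Qed.

Let measurable_unconsr : measurable_fun setT unconsr.
Proof.
apply: measurable_fun_pair; first exact: measurable_coord.
apply: measurable_fun_rV => i; under eq_fun do rewrite mxE.
exact: measurable_coord.
Qed.

Let step_sigma_finite : sigma_finite setT lebesgue_step.
Proof.
have /sigma_finiteP[F [FT ndF Foo]] := sigma_finiteT (@lebesgue_measure R).
have /sigma_finiteP[G [GT ndG Goo]] := sigma_finiteT m.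
exists (fun k => unconsr @^-1` (F k `*` G k)).
  apply/esym; rewrite -subTset => x _.
  have [i _ Fi] : (\bigcup_i F i) (x 0 ord0 : R) by rewrite -FT.
  have [j _ Gj] : (\bigcup_i G i) (\row_i x 0 (lift ord0 i)) by rewrite -GT.
  exists (maxn i j) => //; split => /=.
    by move: Fi; apply/subsetPset/ndF/leq_maxl.
  by move: Gj; apply/subsetPset/ndG/leq_maxr.
move=> k; have [mF Fk] := Foo k; have [mG Gk] := Goo k; split.
  rewrite -[X in measurable X]setTI; apply: measurable_unconsr => //.
  exact: measurableX.
rewrite /lebesgue_step /pushforward -comp_preimage.
rewrite (_ : unconsr \o _ = id); last by apply/funext => p; exact: consrK.
by rewrite preimage_id product_measure1E// lte_mul_pinfty// ge0_fin_numE.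
Qed.

HB.instance Definition _ := Measure_isSigmaFinite.Build _ _ _ lebesgue_step
  step_sigma_finite.


End step.

Fixpoint lebesgue_rV n : {sigma_finite_measure set 'rV[R]_n -> \bar R} :=
  if n is n'.+1 then lebesgue_step (lebesgue_rV n') else dirac (0 : 'rV[R]_0).

Lemma lebesgue_rV_box n (a b : 'rV[R]_n) : (forall i, a 0 i <= b 0 i) ->
  lebesgue_rV n [set x | forall i, a 0 i <= x 0 i <= b 0 i] =
  (\prod_i (b 0 i - a 0 i))%:E.
Proof.
elim: n => [|n IH] in a b *.
  move=> _; rewrite big_ord0 /= diracE mem_set// => -[].
  done.
move=> ab; pose tl (x : 'rV[R]_n.+1) : 'rV[R]_n := \row_i x 0 (lift ord0 i).
rewrite big_ord_recl EFinM /=.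
have -> : (\prod_(i < n) (b 0 (lift ord0 i) - a 0 (lift ord0 i)))%:E =
    lebesgue_rV n [set x | forall i, tl a 0 i <= x 0 i <= tl b 0 i].
  rewrite IH => [|i]; last by rewrite !mxE.
  by congr EFin; apply: eq_bigr => i _; rewrite !mxE.
have -> : (b 0 ord0 - a 0 ord0)%:E =
    lebesgue_measure `[a 0 ord0, b 0 ord0]%classic.
  by rewrite lebesgue_measure_itv/= lte_fin; case: ltgtP (ab ord0) => // ->; rewrite subrr.
rewrite -product_measure1E//; last first.
  rewrite (_ : mkset _ = \bigcap_(i in [set: 'I_n])
      ((fun x => x 0 i) @^-1` `[tl a 0 i, tl b 0 i])); last first.
    apply/seteqP; split=> x /= abx i; last by have := abx i I; rewrite /= in_itv.
    by move=> _; rewrite /= in_itv/=; exact: abx.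
  apply: fin_bigcap_measurable => // i _; rewrite -[X in measurable X]setTI.
  exact: measurable_coord.
rewrite /lebesgue_step /pushforward; congr (_ _).
apply/seteqP; split=> -[t x] /=.
  move=> abx; split; first by have := abx ord0; rewrite consr0 in_itv.
  by move=> i; have := abx (lift ord0 i); rewrite consr_lift !mxE.
move=> [/= tab xab] i; case: (unliftP ord0 i) => [j|] ->.
  by rewrite consr_lift; have := xab j; rewrite !mxE.
by rewrite consr0; move: tab; rewrite in_itv.
Qed.

End lebesgue_rV.

(* A normed space is given as a linear subspace [S] of an ambient left module
   together with a seminorm [N] on [S], the vectors of [S] being understood up
   to the kernel of [N].  A functional which is bounded with respect to [N]
   respects this identification, so that no quotient is needed; only its values
   on [S] are meaningful. *)
Section normed_dual.
Context {R : realType} {E : lmodType R}.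
Variables (S : set E) (N : E -> R).

Definition cont_dual : set (E -> R) := [set L |
  (forall (a : R) v w, S v -> S w -> L (a *: v + w) = a * L v + L w) /\
  exists C : R, forall v, S v -> `|L v| <= C * N v].

Definition cont_dual_norm (L : E -> R) : R :=
  sup [set `|L v| | v in [set v | S v /\ N v <= 1]].

Definition weakly_null (v : nat -> E) : Prop :=
  (forall k, S (v k)) /\
  forall L, cont_dual L -> L (v k) @[k --> \oo] --> (0 : R).

End normed_dual.

Section sobolev.
Context {R : realType} {n : nat}.
Local Notation V := 'rV[R]_n.
Local Notation mu := (@lebesgue_rV R n).
Implicit Types (U : set V) (u phi : V -> R).

Definition relcompact_in (A U : set V) : Prop :=
  compact (closure A) /\ closure A `<=` U.

Definition partial (i : 'I_n) phi : V -> R :=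
  fun x => 'D_(delta_mx 0 i) phi x.

Definition gradient phi : V -> V := fun x => \row_i partial i phi x.

Definition smooth phi : Prop := forall s : seq 'I_n,
  continuous (foldr partial phi s) /\
  forall i x, derivable (foldr partial phi s) x (delta_mx 0 i).

Definition test_function U phi : Prop :=
  smooth phi /\ relcompact_in [set x | phi x != 0] U.

Definition L2 U u : Prop :=
  measurable_fun U u /\ mu.-integrable U (fun x => (u x ^+ 2)%:E).

Definition Linfty U u : Prop :=
  measurable_fun U u /\
  exists M : R, {ae mu, forall x, U x -> `|u x| <= M}.

Definition dot (a b : V) : R := \sum_i a 0 i * b 0 i.

(* An element of [H^1(U)] is a pair [(u, g)] of representatives of a function
   and of its weak gradient, which is unique up to a null set; carrying [g]
   along avoids choosing it. *)
Local Notation E := ((V -> R) * (V -> V))%type.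

Definition weak_gradient U u (g : V -> V) : Prop :=
  forall phi, test_function U phi -> forall i,
    \int[mu]_(x in U) (u x * partial i phi x) =
    - \int[mu]_(x in U) (g x 0 i * phi x).

Definition H1 U : set E := [set w : E |
  [/\ L2 U w.1, (forall i, L2 U (fun x => w.2 x 0 i)) &
      weak_gradient U w.1 w.2]].

Definition H1_norm U (w : E) : R :=
  Num.sqrt (\int[mu]_(x in U) (w.1 x ^+ 2) +
            \int[mu]_(x in U) dot (w.2 x) (w.2 x)).

Definition H10 U : set E := [set w : E | H1 U w /\
  exists phi : nat -> V -> R, (forall j, test_function U (phi j)) /\
    H1_norm U (w - (phi j, gradient (phi j))) @[j --> \oo] --> (0 : R)].

(* On [H10 U] with [U] bounded this seminorm only vanishes on pairs that are
   null almost everywhere, by the Poincare inequality. *)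
Definition H10_norm U (w : E) : R :=
  Num.sqrt (\int[mu]_(x in U) dot (w.2 x) (w.2 x)).

Definition Hm1 U : set (E -> R) := cont_dual (H10 U) (H10_norm U).

Definition Hm1_norm U : (E -> R) -> R := cont_dual_norm (H10 U) (H10_norm U).

Definition Hm1_of_fun U u : E -> R :=
  fun w => \int[mu]_(x in U) (u x * w.1 x).

Definition energy (f : V -> R) U (w : E) : R :=
  2^-1 * \int[mu]_(x in U) dot (w.2 x) (w.2 x) -
  \int[mu]_(x in U) (f x * w.1 x).

Local Open Scope ereal_scope.

Definition nu' (f : nat -> V -> R) U : \bar R :=
  - ereal_inf [set limn_einf (fun k => (energy (f k) U (v k))%:E) |
                 v in weakly_null (H10 U) (H10_norm U)].

Definition nu'' (f : nat -> V -> R) U : \bar R :=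
  - ereal_inf [set limn_esup (fun k => (energy (f k) U (v k))%:E) |
                 v in weakly_null (H10 U) (H10_norm U)].

Definition inner_sup (m : set V -> \bar R) U : \bar R :=
  ereal_sup [set m A | A in [set A | open A /\ relcompact_in A U]].

Local Close Scope ereal_scope.

Definition rich (Omega : set V) (C : set (set V)) : Prop :=
  (forall U, C U -> open U /\ U `<=` Omega) /\
  forall Ut : R -> set V,
    (forall t, 0 < t < 1 -> open (Ut t) /\ Ut t `<=` Omega) ->
    (forall s t, 0 < s < 1 -> 0 < t < 1 -> s < t ->
       relcompact_in (Ut s) (Ut t)) ->
    countable [set t | 0 < t < 1 /\ ~ C (Ut t)].

End sobolev.

(* Main.v *)
Require Import Defs.
From mathcomp Require Import all_boot all_order all_algebra.
From mathcomp Require Import all_classical all_reals all_analysis.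
From mathcomp Require Import measurable_realfun.
From mathcomp Require Import zify ring lra.

Set Implicit Arguments.
Unset Strict Implicit.
Unset Printing Implicit Defensive.
Import Order.TTheory GRing.Theory Num.Theory.
Import numFieldNormedType.Exports.
Local Open Scope classical_set_scope.
Local Open Scope ring_scope.

(** The point x0 is adherent to U0 but not in it, so U0 contains pairwise disjoint
    boxes K_k shrinking to x0 ([exists_boxes]).  Let w_k be a smooth bump supported in
    K_k, scaled so that the integral of |grad w_k|^2 is 2
    ([exists_normalized_bump]), and let f_k be minus the Laplacian of w_k, a
    continuous function with compact support.

    For every open U and v in H^1_0(U), integration by parts turns the integral of
    f_k v over U into that of grad w_k . grad v, even if U cuts K_k
    ([H10_weak_gradient]).  Completing the square ([energyE]),
      F_k(v, U) = 1/2 int_U |grad v - grad w_k|^2 - 1/2 int_U |grad w_k|^2 >= -1,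
    whence nu'(U) <= 1 for all U.  If K_k is contained in U for large k, then w_k is
    admissible with energy exactly -1, and nu'(U) = nu''(U) = 1: this applies to U0
    and to the open sets containing x0.  If the closure of U does not contain x0,
    then f_k = 0 on U for large k and nu'(U) = nu''(U) = 0.

    The supports are disjoint, so the gradients of the w_k are orthogonal, and they are
    bounded in L^2; hence, by Bessel's inequality, w_k tends weakly to 0 in H^1_0 and
    f_k tends weakly to 0 in H^-1(Omega).  The lemma [bessel_weakly_null] covers both
    spaces because it only uses the norms of finite linear combinations.

    An increasing family of open sets has at most one member with x0 on its boundary
    ([rich_off_point]), which gives richness.  The supremum of nu' or nu'' over the
    open sets relatively compact in U is 1 if x0 is in U and 0 otherwise
    ([inner_sup_dirac]).  Since x0 is not in U0, nu(U0) = 0. *)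

(** * A family of flat functions of one variable *)

Section deriv.
Context {R : realType}.

(** This reduces directional derivatives to one variable, where the chain rule, the
    mean value theorem and the fundamental theorem of calculus apply. *)
Lemma is_derive_line (V : normedModType R) (f : V -> R) (x v : V) (t l : R) :
  is_derive (t *: v + x) v f l <-> is_derive t 1 (fun s => f (s *: v + x)) l.
Proof.
have E : (fun h : R =>
      h^-1 *: ((f \o shift (t *: v + x)) (h *: v) - f (t *: v + x))) =
    (fun h : R => h^-1 *: (((fun s => f (s *: v + x)) \o shift t) (h *: (1:R)) -
      f (t *: v + x))).
  by apply/funext => h /=; rewrite -[h *: (1 : R)]/(h * 1) mulr1 scalerDl addrA.
by split=> -[d e]; split; move: d e; rewrite /derivable /derive E.
Qed.

Lemma exprn_expRN_le (k : nat) (s : R) :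
  0 <= s -> s ^+ k * expR (- s) <= k`!%:R.
Proof.
move=> s0; rewrite expRN ler_pdivrMr ?expR_gt0//.
case: k => [|k].
  by rewrite expr0 fact0 mul1r (le_trans _ (expR_ge1Dx _))// lerDl.
have := expR_ge1Dxn k s0; rewrite -ler_pdivrMl ?ltr0n ?fact_gt0// mulrC => H.
by apply: le_trans H; rewrite lerDr.
Qed.

Lemma horner_expRN_bounded (p : {poly R}) :
  exists M : R, forall s, 0 <= s -> `|p.[s]| * expR (- s) <= M.
Proof.
exists (\sum_(i < size p) `|p`_i| * i`!%:R) => s s0.
rewrite horner_coef.
apply: le_trans (_ : (\sum_(i < size p) `|p`_i * s ^+ i|) * expR (- s) <= _).
  by rewrite ler_wpM2r ?expR_ge0// ler_norm_sum.
rewrite mulr_suml; apply: ler_sum => i _.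
rewrite normrM -mulrA ler_wpM2l// ger0_norm ?exprn_ge0//.
exact: exprn_expRN_le.
Qed.

(** The derivative of p(1/t) exp(-1/t) has the same form for another polynomial,
    so carrying the polynomial p along makes the family stable under derivation
    and gives all the derivatives of exp(-1/t) at once. *)
Definition flat (p : {poly R}) (t : R) : R :=
  if 0 < t then p.[t^-1] * expR (- t^-1) else 0.

(** The chain rule gives the formula for t > 0.  At 0, the boundedness of
    s^2 p(s) exp(-s) for s = 1/t makes the function O(t^2), hence of derivative 0. *)
Lemma is_derive_flat (p : {poly R}) (t : R) :
  is_derive t 1 (flat p) (flat ('X^2 * (p - p^`())) t).
Proof.
have [t0|t0|->] := ltgtP t 0.
- rewrite {2}/flat ltNge (ltW t0)/=.
  apply: (near_eq_is_derive (f := cst 0)).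
    by near=> s; rewrite /flat ltNge ltW//=; near: s; exact: lt_nbhsl.
- have tn0 : t != 0 by rewrite gt_eqF.
  have di : is_derive t (1 : R) (fun s : R => s^-1) (- t ^- 2).
    apply: is_derive_eq (is_deriveV (f := id) tn0 (is_derive_id t 1)) _.
    exact: mulr1.
  have d1 : is_derive t (1 : R) (horner p \o (fun s : R => s^-1))
      (p^`().[t^-1] * (- t ^- 2)).
    exact: is_derive1_comp.
  have d2 : is_derive t (1 : R) (expR \o (fun s : R => - s^-1))
      (expR (- t^-1) * t ^- 2).
    apply: (is_derive1_comp (f := expR)).
    by apply: is_derive_eq; rewrite opprK.
  apply: (near_eq_is_derive (f := (horner p \o (fun s : R => s^-1)) *
      (expR \o (fun s : R => - s^-1)))).
    by near=> s; rewrite /flat ifT//; near: s; exact: lt_nbhsr.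
  apply: is_derive_eq.
  rewrite /flat t0 !hornerE /GRing.scale/= -exprVn.
  ring.
- rewrite {2}/flat ltxx.
  have [M HM] := horner_expRN_bounded ('X^2 * p).
  have flatM h : `|flat p h| <= M * h ^+ 2.
    have M0 : 0 <= M by apply: le_trans (HM 0 (lexx _)); rewrite mulr_ge0 ?expR_ge0.
    rewrite /flat; case: ifPn => [h0|_]; last by rewrite normr0 mulr_ge0 ?sqr_ge0.
    have := HM h^-1; rewrite invr_ge0 (ltW h0) => /(_ isT).
    rewrite hornerM hornerXn normrM ger0_norm ?sqr_ge0// [`|_ * expR _|]normrM.
    rewrite (ger0_norm (expR_ge0 _)) -mulrA exprVn ler_pdivrMl ?exprn_gt0// mulrC.
    by rewrite [_ ^+ 2 * M]mulrC.
  have cv : (h^-1 *: ((flat p \o shift 0) (h *: (1 : R)) - flat p 0))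
      @[h --> 0^'] --> (0 : R).
    apply/cvgr0Pnorm_le => e e0; near=> h.
    have hn0 : h != 0 by near: h; exact: nbhs_dnbhs_neq.
    rewrite /= addr0 /GRing.scale/= mulr1 {2}/flat ltxx subr0 normrM normfV.
    rewrite ler_pdivrMl ?normr_gt0// (le_trans (flatM h))//.
    rewrite -(real_normK (num_real h)) expr2 mulrA mulrC ler_wpM2l//.
    have : `|h| <= e / (`|M| + 1).
      near: h; apply: dnbhs0_le; rewrite divr_gt0// ltr_wpDl//.
    rewrite ler_pdivlMr ?ltr_wpDl// => /(le_trans _)-> //.
    rewrite mulrC ler_wpM2l// (le_trans (ler_norm _))// lerDl//.
  split; first by apply/cvg_ex; exists 0.
  exact: cvg_lim cv.
Unshelve. all: by end_near. Qed.

End deriv.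

(** * Smooth functions of several variables *)

Section continuity.
Context {R : realType} {T : topologicalType}.
Implicit Types f g : T -> R.

Lemma continuousD_fun f g : continuous f -> continuous g ->
  continuous (fun x => f x + g x).
Proof.
by move=> cf cg x; apply: (@continuousD _ R^o _ f g); [exact: cf|exact: cg].
Qed.

Lemma continuousM_fun f g : continuous f -> continuous g ->
  continuous (fun x => f x * g x).
Proof. by move=> cf cg x; apply: continuousM; [exact: cf|exact: cg]. Qed.

Lemma continuousMl_fun f (a : R) : continuous f -> continuous (fun x => a * f x).
Proof.
by move=> cf; apply: (continuousM_fun (f := fun=> a)) => // x; exact: cvg_cst.
Qed.

End continuity.

Section smooth_theory.
Context {R : realType} {n : nat}.
Local Notation V := 'rV[R]_n.
Implicit Types f g : V -> R.

Lemma smoothP f : smooth f <-> [/\ continuous f,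
  forall i x, derivable f x (delta_mx 0 i) & forall i, smooth (partial i f)].
Proof.
split=> [sf|[cf df sf] s].
  split; [exact: (sf [::]).1|exact: (sf [::]).2|].
  by move=> i s; have := sf (rcons s i); rewrite foldr_rcons.
by case/lastP: s => [//|s i]; rewrite foldr_rcons; exact: sf.
Qed.

Lemma smooth_continuous f : smooth f -> continuous f.
Proof. by case/smoothP. Qed.

Lemma smooth_derivable f i x : smooth f -> derivable f x (delta_mx 0 i).
Proof. by case/smoothP=> _ + _; exact. Qed.

Lemma smooth_partial f i : smooth f -> smooth (partial i f).
Proof. by case/smoothP. Qed.

Lemma smooth_is_derive f i x :
  smooth f -> is_derive x (delta_mx 0 i) f (partial i f x).
Proof. by move=> sf; apply/derivableP; exact: smooth_derivable. Qed.

Lemma partial_lin f g (a : R) i : smooth f -> smooth g ->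
  partial i (a *: f + g) = a *: partial i f + partial i g.
Proof.
move=> sf sg; apply/funext => x.
have fx := smooth_is_derive i x sf; have gx := smooth_is_derive i x sg.
by rewrite /partial derive_val.
Qed.

Lemma partialM f g i : smooth f -> smooth g ->
  partial i (f * g) = f * partial i g + g * partial i f.
Proof.
move=> sf sg; apply/funext => x.
have fx := smooth_is_derive i x sf; have gx := smooth_is_derive i x sg.
by rewrite /partial derive_val.
Qed.

(** Smooth functions form the largest class of continuous, partially derivable
    functions that is stable under partial derivatives.  Exhibiting any such class
    replaces an induction on the sequence of derivation directions, in which the
    Leibniz rule would have to be iterated. *)
Lemma smooth_coind (C : set (V -> R)) :
  (forall f, C f -> [/\ continuous f,
    forall i x, derivable f x (delta_mx 0 i) & forall i, C (partial i f)]) ->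
  C `<=` smooth.
Proof.
move=> HC f Cf s; elim/last_ind: s f Cf => [|s i IH] f /HC[cf df Cf].
  by split.
by rewrite foldr_rcons; exact: IH.
Qed.

Lemma smooth_lin f g (a : R) : smooth f -> smooth g -> smooth (a *: f + g).
Proof.
move=> sf sg; apply: (@smooth_coind [set h | exists f g,
    [/\ smooth f, smooth g & h = a *: f + g]]); last by exists f, g.
move=> _ [{sf}f [{sg}g [sf sg ->]]]; split=> [|i x|i].
- apply: (continuousD_fun (f := a *: f)); last exact: smooth_continuous.
  by apply: continuousMl_fun; exact: smooth_continuous.
- by apply: derivableD; [apply: derivableZ|]; exact: smooth_derivable.
- exists (partial i f), (partial i g).
  by split; [exact: smooth_partial|exact: smooth_partial|exact: partial_lin].
Qed.

Lemma smooth_cst (c : R) : smooth (cst c : V -> R).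
Proof.
apply: (@smooth_coind [set h | exists c, h = cst c]); last by exists c.
move=> _ [{}c ->]; split=> [|i x|i]; first exact: cst_continuous.
  exact: derivable_cst.
by exists 0; apply/funext => x; rewrite /partial derive_cst.
Qed.

Lemma smoothD f g : smooth f -> smooth g -> smooth (f + g).
Proof. by move=> sf sg; rewrite -[f]scale1r; exact: smooth_lin. Qed.

Lemma smoothZ f (a : R) : smooth f -> smooth (a *: f).
Proof.
move=> sf; rewrite -[_ *: _]addr0.
by apply: smooth_lin; [exact: sf|exact: smooth_cst].
Qed.

(** The class generated by the products of two smooth functions under addition is
    stable under partial derivatives, by the Leibniz rule. *)
Inductive sum_of_products : (V -> R) -> Prop :=
| SumOfProducts_mul f g of smooth f & smooth g : sum_of_products (f * g)
| SumOfProducts_add h k of sum_of_products h & sum_of_products k :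
    sum_of_products (h + k).

Lemma smoothM f g : smooth f -> smooth g -> smooth (f * g).
Proof.
move=> sf sg; apply: (@smooth_coind sum_of_products); last exact: SumOfProducts_mul.
move=> h; elim=> [{sf}f {sg}g sf sg|{}h k _ [ch dh ph] _ [ck dk pk]]; split.
- by apply: continuousM_fun; exact: smooth_continuous.
- by move=> i x; apply: derivableM; exact: smooth_derivable.
- move=> i; rewrite (partialM i sf sg).
  apply: SumOfProducts_add; apply: SumOfProducts_mul;
    [exact: sf|exact: smooth_partial|exact: sg|exact: smooth_partial].
- exact: continuousD_fun.
- by move=> i x; exact: derivableD.
- move=> i; rewrite (_ : partial i (h + k) = partial i h + partial i k).
    exact: SumOfProducts_add.
  by apply/funext => x; rewrite /partial deriveD.
Qed.

(** A partial derivative of x |-> b G(s x_i + a) is again of this form, with G'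
    for G and b s or 0 for b; hence a class D of functions of one variable that is
    stable under derivation yields smooth functions of x_i. *)
Lemma smooth_coordwise (D : set (R -> R)) (G : R -> R) (i : 'I_n) (s a : R) :
  (forall H, D H ->
    exists2 H', D H' & forall t : R, is_derive t (1 : R) H (H' t)) ->
  D G -> smooth (fun x : V => G (s * x 0 i + a)).
Proof.
move=> HD DG; apply: (@smooth_coind [set h | exists G b,
    D G /\ h = (fun x : V => b * G (s * x 0 i + a))]); last first.
  by exists G, 1; split=> //; apply/funext => x; rewrite mul1r.
move=> _ [{DG}G [b [DG ->]]]; have [G' DG' dG] := HD _ DG.
have dj j (x : V) : is_derive x (delta_mx 0 j)
    (fun x : V => b * G (s * x 0 i + a))
    (b * (s * (i == j)%:R) * G' (s * x 0 i + a)).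
  rewrite -[x]add0r -(scale0r (delta_mx 0 j)); apply/is_derive_line.
  pose L (t : R) := s * (i == j)%:R * t + (s * x 0 i + a).
  have dL : is_derive (0 : R) (1 : R) L (s * (i == j)%:R).
    apply: is_derive_eq; rewrite addr0; exact: mulr1.
  have dGL : is_derive (0 : R) (1 : R) (G \o L) (G' (L 0) * (s * (i == j)%:R)).
    exact: is_derive1_comp.
  rewrite scale0r add0r.
  rewrite (_ : (fun _ => _) = b *: (G \o L)); last first.
    apply/funext => t; rewrite /L /= !mxE eqxx/=; congr (b * G _).
    by rewrite eq_sym; ring.
  apply: is_derive_eq; rewrite /L mulr0 add0r -[_ *: _]/(b * _); ring.
split=> [|j x|j].
- apply: continuousMl_fun => x.
  apply: (@continuous_comp _ _ _ (fun x : V => s * x 0 i + a) G).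
    apply: (continuousD_fun (f := fun x : V => s * x 0 i)).
      by apply: continuousMl_fun; exact: coord_continuous.
    exact: cst_continuous.
  apply/differentiable_continuous/derivable1_diffP.
  by have [] := dG (s * x 0 i + a).
- by have [] := dj j x.
- exists G', (b * (s * (i == j)%:R)); split=> //; apply/funext => x.
  by have [_] := dj j x.
Qed.

End smooth_theory.

(** * Boxes and functions with bounded support *)

Section box.
Context {R : realType} {n : nat}.
Local Notation V := 'rV[R]_n.
Local Notation mu := (@lebesgue_rV R n).

Definition box (c : V) (r : R) : set V :=
  [set x | forall i, `|x 0 i - c 0 i| <= r].

Lemma box_itv c r :
  box c r = [set x | forall i, `[c 0 i - r, c 0 i + r]%classic (x 0 i)].
Proof.
by apply/seteqP; split=> x h i; have := h i; rewrite /= in_itv/= ler_distl.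
Qed.

Lemma compact_box c r : compact (box c r).
Proof.
rewrite box_itv.
apply: (rV_compact (A := fun i => `[c 0 i - r, c 0 i + r]%classic)) => i.
exact: segment_compact.
Qed.

Lemma closed_box c r : closed (box c r).
Proof.
by apply: compact_closed; [exact: norm_hausdorff|exact: compact_box].
Qed.

Lemma measurable_box c r : measurable (box c r).
Proof.
rewrite -(setCK (box c r)); apply: measurableC; apply: open_measurable_rV.
exact/closed_openC/closed_box.
Qed.

Lemma lebesgue_rV_boxE c r : 0 <= r -> mu (box c r) = (\prod_(i < n) (r + r))%:E.
Proof.
move=> r0; rewrite (_ : box c r = [set x | forall i,
    (c - const_mx r) 0 i <= x 0 i <= (c + const_mx r) 0 i]).
  rewrite lebesgue_rV_box => [|i]; last by rewrite !mxE; lra.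
  by congr EFin; apply: eq_bigr => i _; rewrite !mxE; ring.
by apply/seteqP; split=> x h i; have := h i; rewrite !mxE ler_distl.
Qed.

Lemma lebesgue_rV_box_lty c r : (mu (box c r) < +oo)%E.
Proof.
apply: (@le_lt_trans _ _ (mu (box c `|r|))).
  apply: le_measure; rewrite ?inE; try exact: measurable_box.
  by move=> x h i; rewrite (le_trans (h i))// ler_norm.
by rewrite lebesgue_rV_boxE// ltry.
Qed.

Lemma compact_sub_box (K : set V) : compact K -> exists r, K `<=` box 0 r.
Proof.
move=> /compact_bounded[M [_ HM]]; exists (M + 1) => x Kx i; rewrite mxE subr0.
have := HM (M + 1); rewrite ltrDl ltr01 => /(_ isT _ Kx); apply: le_trans.
rewrite [leRHS]/Num.norm /= mx_normrE; apply/bigmax_geP; right => /=.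
by exists (0, i).
Qed.

Lemma continuous_measurable_rV (f : V -> R) (D : set V) :
  continuous f -> measurable_fun D f.
Proof.
move=> cf; apply: measurable_funTS.
apply: (measurability _ (RGenOpens.measurableE R)).
move=> _ [_ [a [b ->] <-]]; rewrite setTI; apply: open_measurable_rV.
apply: open_comp; last exact: interval_open.
by move=> x _; exact: cf.
Qed.

Definition bounded_support (f : V -> R) :=
  exists r, forall x, ~ box 0 r x -> f x = 0.

Lemma bounded_supportM (f g : V -> R) :
  bounded_support f -> bounded_support (fun x => f x * g x).
Proof. by move=> [r fr]; exists r => x /fr ->; rewrite mul0r. Qed.

Lemma continuous_bounded (f : V -> R) : continuous f -> bounded_support f ->
  exists M, forall x, `|f x| <= M.
Proof.
move=> cf [r fr].
have cK : compact (f @` box 0 r).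
  by apply: continuous_compact; [exact: continuous_subspaceT|exact: compact_box].
have [M [_ HM]] := compact_bounded cK.
exists (Num.max 0 (M + 1)) => x; have [xr|/fr->] := pselect (box 0 r x).
  by rewrite le_max (HM (M + 1)) ?orbT// ?ltrDl//; exists x.
by rewrite normr0 le_max lexx.
Qed.

Lemma integrable_continuous (f : V -> R) (D : set V) : measurable D ->
  continuous f -> bounded_support f -> mu.-integrable D (EFin \o f).
Proof.
move=> mD cf sf; apply: (@integrableS _ _ _ _ setT) => //.
have [M fM] := continuous_bounded cf sf.
have [r fr] := sf.
rewrite (_ : EFin \o f = (EFin \o f) \_ (box 0 r)).
  apply/(integrable_mkcond _ (measurable_box 0 r)).
  apply: measurable_bounded_integrable; first exact: measurable_box.
  - exact: lebesgue_rV_box_lty.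
  - exact: continuous_measurable_rV.
  - exists M; split; first exact: num_real.
    by move=> N MN x _; apply: le_trans (fM x) (ltW MN).
apply/funext => x; rewrite patchE; case: ifPn => // /negP xr.
by rewrite /= fr// => /mem_set.
Qed.

End box.

(** * Integrals of partial derivatives *)

Section ibp.
Context {R : realType}.

Lemma integral_derive1_eq0 (F dF : R -> R) (r : R) : continuous dF ->
  (forall t, is_derive t (1 : R) F (dF t)) ->
  (forall t, r < `|t| -> F t = 0 /\ dF t = 0) ->
  (\int[@lebesgue_measure R]_t (dF t)%:E = 0)%E.
Proof.
move=> cdF dF1 sF.
(* the bounds lie strictly outside the support, so that F vanishes at both *)
pose a := - (`|r| + 1); pose b := `|r| + 1.
have ab : a < b by rewrite /a /b; have := normr_ge0 r; lra.
have out t : t \notin `[a, b] -> F t = 0 /\ dF t = 0.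
  move=> tab; apply: sF; rewrite ltNge; apply: contra tab => tr.
  by rewrite in_itv/= -ler_norml (le_trans tr)// (le_trans (ler_norm _))// lerDl.
have cF : continuous F.
  by move=> t; apply/differentiable_continuous/derivable1_diffP; have [] := dF1 t.
have Fab t : `|t| = b -> F t = 0.
  by move=> tb; apply: (sF _ _).1; rewrite tb /b; have := ler_norm r; lra.
have b0 : 0 < b by rewrite /b ltr_wpDl.
have -> : (\int[@lebesgue_measure R]_t (dF t)%:E =
    \int[@lebesgue_measure R]_(t in `[a, b]) (dF t)%:E)%E.
  rewrite [RHS]integral_mkcond; apply: eq_integral => t _.
  by rewrite patchE; case: ifPn => //; rewrite notin_setE/= => /negP/out[_ ->].
rewrite (@continuous_FTC2 _ dF F)//.
- have bb : `|b| = b by rewrite gtr0_norm.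
  by rewrite !Fab ?sube0// /a normrN.
- exact: continuous_subspaceT.
- split=> [t _||]; first by have [] := dF1 t.
    by apply: cvg_at_right_filter; exact: cF.
  by apply: cvg_at_left_filter; exact: cF.
- by move=> t _; rewrite derive1E; have [] := dF1 t.
Qed.

Lemma integral_lebesgue_rVS n (f : 'rV[R]_n.+1 -> R) :
  continuous f -> bounded_support f ->
  (\int[lebesgue_rV n.+1]_x (f x)%:E =
   \int[lebesgue_measure \x lebesgue_rV n]_p (f (consr p))%:E)%E /\
  (lebesgue_measure \x lebesgue_rV n)%E.-integrable setT
    (fun p => (f (consr p))%:E).
Proof.
move=> cf sf.
have If := integrable_continuous measurableT cf sf.
have mf : measurable_fun setT (EFin \o f).
  by apply/measurable_EFinP; exact: continuous_measurable_rV.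
have I2 : (lebesgue_measure \x lebesgue_rV n)%E.-integrable setT
    (fun p => (f (consr p))%:E).
  apply/integrableP; split.
    by apply: (measurableT_comp mf); exact: measurable_consr.
  case/integrableP: If => _; apply: le_lt_trans.
  rewrite [leRHS](ge0_integral_pushforward (@measurable_consr R n))//.
  exact: measurableT_comp.
split=> //.
exact: (integral_pushforward (@measurable_consr R n) mf).
Qed.

Lemma continuous_rV (T : topologicalType) n (g : T -> 'rV[R]_n) :
  (forall i, continuous (fun y => g y 0 i : R)) -> continuous g.
Proof.
move=> cg y; apply/cvg_ballP => e e0.
suff H : \forall z \near y, forall i, `|g y 0 i - g z 0 i| < e.
  by apply: filterS H => z gz; apply/rV_ballP.
apply: filter_forall => i.
by have /cvgrPdist_lt := cg i y; apply.
Qed.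

Lemma consrD n (s t : R) (x y : 'rV[R]_n) :
  consr (s + t, x + y) = consr (s, x) + consr (t, y).
Proof.
apply/rowP => i; rewrite [RHS]mxE; case: (unliftP ord0 i) => [j|] ->.
  by rewrite !consr_lift mxE.
by rewrite !consr0.
Qed.

Lemma consr_delta_lift n (s : R) (j : 'I_n) :
  consr (0 : R, s *: delta_mx 0 j) = s *: delta_mx 0 (lift ord0 j).
Proof.
apply/rowP => i; rewrite [RHS]mxE [X in _ * X]mxE eqxx/=.
case: (unliftP ord0 i) => [k|] ->.
  by rewrite consr_lift !mxE eqxx/= (inj_eq lift_inj).
by rewrite consr0/= mulr0.
Qed.

Lemma consr_delta0 n (s : R) : consr (s, 0 : 'rV[R]_n) = s *: delta_mx 0 ord0.
Proof.
apply/rowP => i; rewrite [RHS]mxE [X in _ * X]mxE eqxx/=.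
case: (unliftP ord0 i) => [k|] ->.
  by rewrite consr_lift !mxE/= mulr0.
by rewrite consr0 mulr1.
Qed.

Lemma continuous_consrl n (x : 'rV[R]_n) : continuous (fun t : R => consr (t, x)).
Proof.
apply: continuous_rV => i; case: (unliftP ord0 i) => [k|] ->.
  rewrite (_ : (fun _ => _) = cst (x 0 k)); first exact: cst_continuous.
  by apply/funext => t; rewrite consr_lift.
rewrite (_ : (fun _ => _) = id) => [t|]; first exact: cvg_id.
by apply/funext => t; rewrite consr0.
Qed.

Lemma continuous_consrr n (t : R) : continuous (fun x : 'rV[R]_n => consr (t, x)).
Proof.
apply: continuous_rV => i; case: (unliftP ord0 i) => [k|] ->.
  rewrite (_ : (fun _ => _) = (fun x : 'rV[R]_n => x 0 k)).
    exact: coord_continuous.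
  by apply/funext => x; rewrite consr_lift.
rewrite (_ : (fun _ => _) = cst t); first exact: cst_continuous.
by apply/funext => x; rewrite consr0.
Qed.

(** By Fubini and induction on the dimension: for the first coordinate, the inner
    integral over the line vanishes by the fundamental theorem of calculus; for
    another one, the inner integral over the remaining coordinates vanishes by the
    induction hypothesis. *)
Lemma integral_derive_eq0 n (i : 'I_n) (F dF : 'rV[R]_n -> R) (r : R) :
  continuous dF -> (forall x, is_derive x (delta_mx 0 i) F (dF x)) ->
  (forall x, ~ box 0 r x -> F x = 0 /\ dF x = 0) ->
  (\int[lebesgue_rV n]_x (dF x)%:E = 0)%E.
Proof.
elim: n i F dF => [[]//|n IH] i F dF cdF dF1 sF.
have sdF : bounded_support dF by exists r => x /sF[].
have [-> I2] := integral_lebesgue_rVS cdF sdF.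
have boxr t x : box 0 r (consr (t, x)) -> `|t| <= r /\ box 0 r x.
  move=> h; split=> [|j]; first by have := h ord0; rewrite consr0 mxE subr0.
  by have := h (lift ord0 j); rewrite consr_lift !mxE.
case: (unliftP ord0 i) => [j|] ji.
  rewrite -integral12_prod_meas1//; apply: integral0_eq => t _ /=.
  rewrite /fubini_F/=.
  apply: (IH j (fun x => F (consr (t, x))) (fun x => dF (consr (t, x)))).
  - move=> x; apply: (@continuous_comp _ _ _ (fun x => consr (t, x)) dF); last exact: cdF.
    exact: continuous_consrr.
  - move=> x; rewrite -[x]add0r -(scale0r (delta_mx 0 j)); apply/is_derive_line.
    have := dF1 (consr (t, x)).
    rewrite ji -[consr (t, x)]add0r -(scale0r (delta_mx 0 (lift ord0 j))).
    move=> /is_derive_line; rewrite !scale0r !add0r.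
    by under eq_fun do rewrite -consr_delta_lift -consrD add0r.
  - by move=> x xr; apply: sF => /boxr[].
rewrite -integral21_prod_meas1//; apply: integral0_eq => x _ /=.
rewrite /fubini_G/=.
apply: (integral_derive1_eq0 (F := fun t => F (consr (t, x))) (r := r)).
- move=> t; apply: (@continuous_comp _ _ _ (fun t => consr (t, x)) dF); last exact: cdF.
  exact: continuous_consrl.
- move=> t; have cE s : consr (s, x) = s *: delta_mx 0 ord0 + consr (0, x).
    by rewrite -consr_delta0 -consrD addr0 add0r.
  have := dF1 (consr (t, x)); rewrite ji cE => /is_derive_line.
  by under eq_fun do rewrite -cE.
- by move=> t tr; apply: sF => /boxr[]; rewrite leNgt tr.
Qed.

End ibp.

(** * Test functions *)

Section test_functions.
Context {R : realType} {n : nat}.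
Local Notation V := 'rV[R]_n.
Local Notation mu := (@lebesgue_rV R n).
Implicit Types (U K : set V) (f g phi psi : V -> R).

Definition vanishes_off K f := forall x, ~ K x -> f x = 0.

Lemma partial_vanishes_off K f i : closed K ->
  vanishes_off K f -> vanishes_off K (partial i f).
Proof.
move=> cK fK x Kx; rewrite /partial (@near_eq_derive _ _ _ f (cst 0)) ?derive_cst//.
have : nbhs x (~` K) by apply: open_nbhs_nbhs; split=> //; exact: closed_openC.
by apply: filterS => y /fK.
Qed.

Lemma gradient_vanishes_off K f x : closed K -> vanishes_off K f -> ~ K x ->
  gradient f x = 0.
Proof.
by move=> cK fK Kx; apply/rowP => i; rewrite !mxE (partial_vanishes_off i cK fK).
Qed.

(** Any compact set off which phi vanishes can serve as the support; choosing it
    freely makes sums, products and derivatives of test functions easy to treat. *)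
Lemma test_functionP U phi : test_function U phi <->
  smooth phi /\ exists K, [/\ compact K, closed K, K `<=` U & vanishes_off K phi].
Proof.
split=> [[sphi [cphi phiU]]|[sphi [K [cK clK KU phiK]]]]; split=> //.
  exists (closure [set x | phi x != 0]); split=> //; first exact: closed_closure.
  by move=> x xN; apply: contrapT => /eqP phix; apply: xN; exact: subset_closure.
have sub : closure [set x | phi x != 0] `<=` K.
  rewrite [X in _ `<=` X](closure_id K).1//.
  apply: closure_subset => x /= phix; apply: contrapT => /phiK /eqP.
  by rewrite (negbTE phix).
split; last exact: subset_trans KU.
by apply: subclosed_compact cK sub; exact: closed_closure.
Qed.

Lemma test_function_smooth U phi : test_function U phi -> smooth phi.
Proof. by case. Qed.

Lemma test_function_bounded U phi : test_function U phi -> bounded_support phi.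
Proof.
move=> /test_functionP[_ [K [/compact_sub_box[r Kr] _ _ phiK]]].
by exists r => x xr; apply: phiK => /Kr.
Qed.

Lemma test_function_partial U phi i :
  test_function U phi -> test_function U (partial i phi).
Proof.
move=> /test_functionP[sphi [K [cK clK KU phiK]]]; apply/test_functionP.
split; first exact: smooth_partial.
by exists K; split=> //; exact: partial_vanishes_off.
Qed.

Lemma test_function_lin U phi psi (a : R) :
  test_function U phi -> test_function U psi -> test_function U (a *: phi + psi).
Proof.
move=> /test_functionP[sphi [K [cK clK KU phiK]]].
move=> /test_functionP[spsi [L [cL clL LU psiL]]].
apply/test_functionP; split; first exact: smooth_lin.
exists (K `|` L); split; [exact: compactU|exact: closedU|by move=> x [/KU|/LU]|].
move=> x KLx; have [Kx Lx] : ~ K x /\ ~ L x.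
  by split=> ?; apply: KLx; [left|right].
by rewrite -[LHS]/(a * phi x + psi x) phiK// psiL// mulr0 addr0.
Qed.

Lemma test_functionM U phi psi :
  test_function U phi -> smooth psi -> test_function U (phi * psi).
Proof.
move=> /test_functionP[sphi [K [cK clK KU phiK]]] spsi.
apply/test_functionP; split; first exact: smoothM.
by exists K; split=> // x /phiK phix; rewrite -[LHS]/(phi x * psi x) phix mul0r.
Qed.

Lemma test_function0 U : test_function U (0 : V -> R).
Proof.
apply/test_functionP; split; first exact: smooth_cst.
by exists set0; split=> //; [exact: compact0|exact: closed0].
Qed.

Lemma Rintegral_partial_eq0 U phi i : test_function U phi ->
  \int[mu]_(x in U) partial i phi x = 0.
Proof.
move=> /test_functionP[sphi [K [cK clK KU phiK]]].
have phiK' := partial_vanishes_off i clK phiK.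
rewrite Rintegral_mkcond (_ : _ \_ _ = partial i phi); last first.
  apply/funext => x; rewrite patchE; case: ifPn => // /negP xU.
  by rewrite phiK'// => /KU/mem_set.
have [r Kr] := compact_sub_box cK.
transitivity (fine (0 : \bar R)) => //; congr fine.
apply: (@integral_derive_eq0 _ _ i phi _ r).
- by apply: smooth_continuous; exact: smooth_partial.
- by move=> x; exact: smooth_is_derive.
- by move=> x xr; rewrite phiK ?phiK'// => /Kr.
Qed.

Lemma bounded_support_partial f i :
  bounded_support f -> bounded_support (partial i f).
Proof.
by move=> [r fr]; exists r; apply: partial_vanishes_off => //; exact: closed_box.
Qed.

(** Only phi has to vanish near the boundary of U: the integrand is a derivative of
    the product phi psi, which is itself a test function in U. *)
Lemma integration_by_parts_test U phi psi i : open U ->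
  test_function U phi -> smooth psi ->
  \int[mu]_(x in U) (phi x * partial i psi x) =
  - \int[mu]_(x in U) (partial i phi x * psi x).
Proof.
move=> oU tphi spsi; have mU := open_measurable_rV oU.
have sphi := test_function_smooth tphi.
have bphi := test_function_bounded tphi.
have := Rintegral_partial_eq0 i (test_functionM tphi spsi).
rewrite (partialM i sphi spsi) RintegralD//.
- rewrite addrC [X in X + _ = 0](_ : _ =
      \int[mu]_(x in U) (partial i phi x * psi x)).
    by move/eqP; rewrite addr_eq0 => /eqP ->; rewrite opprK.
  by apply: eq_Rintegral => x _; rewrite -[LHS]/(psi x * partial i phi x) mulrC.
- apply: integrable_continuous mU _ (bounded_supportM _ bphi).
  by apply: continuousM_fun; [|move: (smooth_partial i spsi)];
    exact: smooth_continuous.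
- rewrite (_ : EFin \o _ = EFin \o (fun x => partial i phi x * psi x));
    last first.
    by apply/funext => x /=; rewrite mulrC.
  have bdphi := bounded_support_partial i bphi.
  apply: integrable_continuous mU _ (bounded_supportM _ bdphi).
  by apply: continuousM_fun; [move: (smooth_partial i sphi)|];
    exact: smooth_continuous.
Qed.

Lemma smooth_prod (I : Type) (s : seq I) (F : I -> V -> R) :
  (forall i, smooth (F i)) -> smooth (\prod_(i <- s) F i).
Proof.
move=> sF; apply: big_ind; [exact: smooth_cst|exact: smoothM|].
by move=> i _; exact: sF.
Qed.

Lemma flat1_gt0 (t : R) : 0 < t -> 0 < flat 1 t.
Proof. by move=> t0; rewrite /flat t0 hornerE mul1r expR_gt0. Qed.

Lemma flat_eq0 p (t : R) : t <= 0 -> flat p t = 0.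
Proof. by rewrite /flat ltNge => ->. Qed.

Lemma smooth_flat (i : 'I_n) p (s a : R) :
  smooth (fun x : V => flat p (s * x 0 i + a)).
Proof.
apply: (@smooth_coordwise _ _ (range (@flat R))) => [_ [q _ <-]|]; last by exists p.
exists (flat ('X^2 * (q - q^`()))); first by exists ('X^2 * (q - q^`())).
by move=> t; exact: is_derive_flat.
Qed.

(** The bump is the product over the coordinates of
    exp(-1/(r + x_i - c_i)) exp(-1/(r - x_i + c_i)), extended by 0. *)
Lemma exists_bump (c : V) (r : R) : 0 < r ->
  exists f, [/\ smooth f, vanishes_off (box c r) f & 0 < f c].
Proof.
move=> r0.
pose F (i : 'I_n) : V -> R := (fun x : V => flat 1 (1 * x 0 i + (r - c 0 i))) *
  (fun x : V => flat 1 (-1 * x 0 i + (r + c 0 i))).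
have FE x : (\prod_i F i) x = \prod_i F i x.
  by apply: (big_morph (fun f : V -> R => f x)).
exists (\prod_i F i); split.
- by apply: smooth_prod => i; apply: smoothM; exact: smooth_flat.
- move=> x; rewrite FE => /existsNP[i /negP]; rewrite -ltNge => xr.
  rewrite (bigD1 i)//= -[F i x]/(flat _ _ * flat _ _) mul1r mulN1r.
  have [xc|xc] := leP 0 (x 0 i - c 0 i); move: xr.
    by rewrite ger0_norm// => xr; rewrite [X in _ * X * _]flat_eq0 ?mulr0 ?mul0r//; lra.
  by rewrite ltr0_norm// => xr; rewrite flat_eq0 ?mul0r//; lra.
- rewrite FE; apply: prodr_gt0 => i _.
  rewrite -[F i c]/(flat _ _ * flat _ _).
  by rewrite mulr_gt0//; apply: flat1_gt0; rewrite ?mul1r ?mulN1r; lra.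
Qed.

End test_functions.

(** * Square integrable functions and vector fields *)

Section square_integrable.
Context {R : realType} {n : nat}.
Local Notation V := 'rV[R]_n.
Local Notation mu := (@lebesgue_rV R n).
Variable U : set V.
Hypothesis mU : measurable U.
Implicit Types (f g : V -> R) (X Y : V -> V).

Lemma Rintegral_eq0 f : (forall x, U x -> f x = 0) -> \int[mu]_(x in U) f x = 0.
Proof.
move=> f0; transitivity (\int[mu]_(x in U) (0 : R)); last first.
  by rewrite Rintegral_cst// mul0r.
by apply: eq_Rintegral => x /set_mem; exact: f0.
Qed.

Lemma L2M f g : L2 U f -> L2 U g ->
  mu.-integrable U (EFin \o (fun x => f x * g x)).
Proof.
move=> [mf if2] [mg ig2].
apply: (@le_integrable _ _ _ _ _ mU _ (EFin \o (fun x => f x ^+ 2 + g x ^+ 2))).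
- by apply/measurable_EFinP; exact: measurable_funM.
- move=> x Ux; rewrite /= lee_fin normrM [leRHS]ger0_norm ?addr_ge0 ?sqr_ge0//.
  rewrite -[f x ^+ 2]real_normK ?num_real// -[g x ^+ 2]real_normK ?num_real//.
  have := normr_ge0 (f x); have := normr_ge0 (g x); nra.
- rewrite (_ : EFin \o _ = (fun x => (f x ^+ 2)%:E) \+ (fun x => (g x ^+ 2)%:E))%E//.
  exact: integrableD.
Qed.

Lemma L2_lin f g (a : R) : L2 U f -> L2 U g -> L2 U (fun x => a * f x + g x).
Proof.
move=> fL2 gL2; have [mf if2] := fL2; have [mg ig2] := gL2.
split; first by apply: measurable_funD => //; exact: measurable_funM.
rewrite (_ : (fun x => _) = (fun x => ((a ^+ 2)%:E * (f x ^+ 2)%:E)) \+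
  ((fun x => (2 * a)%:E * (f x * g x)%:E) \+ (fun x => (g x ^+ 2)%:E)))%E.
  apply: integrableD => //; first exact: integrableZl.
  by apply: integrableD => //; apply: integrableZl => //; exact: L2M.
by apply/funext => x /=; rewrite -!EFinM -!EFinD; congr EFin; ring.
Qed.

Lemma L2_continuous f : continuous f -> bounded_support f -> L2 U f.
Proof.
move=> cf bf; split; first exact: continuous_measurable_rV.
rewrite (_ : (fun x => _) = EFin \o (fun x => f x * f x)); last first.
  by apply/funext => x /=; rewrite expr2.
by apply: integrable_continuous => //; [exact: continuousM_fun|exact: bounded_supportM].
Qed.

Definition L2_field X := forall i, L2 U (fun x => X x 0 i).

Lemma L2_field_lin X Y (a : R) : L2_field X -> L2_field Y ->
  L2_field (fun x => a *: X x + Y x).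
Proof.
move=> LX LY i; rewrite (_ : (fun x => _) = (fun x => a * X x 0 i + Y x 0 i)).
  exact: L2_lin.
by apply/funext => x; rewrite !mxE.
Qed.

Lemma integrable_Rsum (I : Type) (s : seq I) (F : I -> V -> R) :
  (forall i, mu.-integrable U (EFin \o F i)) ->
  mu.-integrable U (EFin \o (fun x => \sum_(i <- s) F i x)) /\
  \int[mu]_(x in U) (\sum_(i <- s) F i x) = \sum_(i <- s) \int[mu]_(x in U) F i x.
Proof.
move=> iF; elim: s => [|i s [IH1 IH2]].
  rewrite (_ : (fun x => _) = cst 0); last by apply/funext => x; rewrite big_nil.
  rewrite Rintegral_cst// mul0r big_nil; split=> //.
  exact: integrable0.
have E x : \sum_(j <- i :: s) F j x = F i x + \sum_(j <- s) F j x by rewrite big_cons.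
split.
  rewrite (_ : EFin \o _ = (EFin \o F i) \+
      (EFin \o (fun x => (\sum_(j <- s) F j x)%R)))%E.
    exact: integrableD.
  by apply/funext => x /=; rewrite E EFinD.
under eq_Rintegral do rewrite E.
by rewrite RintegralD// IH2 big_cons.
Qed.

Lemma integrable_dot X Y : L2_field X -> L2_field Y ->
  mu.-integrable U (EFin \o (fun x => dot (X x) (Y x))).
Proof. by move=> LX LY; apply: (integrable_Rsum _ _).1 => i; exact: L2M. Qed.

Lemma Rintegral_dot X Y : L2_field X -> L2_field Y ->
  \int[mu]_(x in U) dot (X x) (Y x) =
  \sum_i \int[mu]_(x in U) (X x 0 i * Y x 0 i).
Proof. by move=> LX LY; apply: (integrable_Rsum _ _).2 => i; exact: L2M. Qed.

Lemma dotDZ (a b c : V) (t : R) :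
  dot (t *: a + b) (t *: a + b) = t ^+ 2 * dot a a + (2 * t * dot a b + dot b b).
Proof.
by rewrite /dot !mulr_sumr -!big_split/=; apply: eq_bigr => i _; rewrite !mxE; ring.
Qed.

Lemma dot0l (a : V) : dot 0 a = 0.
Proof. by rewrite /dot big1// => i _; rewrite mxE mul0r. Qed.

Lemma dotC (a b : V) : dot a b = dot b a.
Proof. by apply: eq_bigr => i _; rewrite mulrC. Qed.

Lemma dotDZl (t : R) (a b c : V) : dot (t *: a + b) c = t * dot a c + dot b c.
Proof.
by rewrite /dot mulr_sumr -big_split/=; apply: eq_bigr => i _; rewrite !mxE; ring.
Qed.

Lemma dot_ge0 (a : V) : 0 <= dot a a.
Proof. by apply: sumr_ge0 => i _; rewrite -expr2 sqr_ge0. Qed.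

Lemma Rintegral_dotDZ X Y t : L2_field X -> L2_field Y ->
  \int[mu]_(x in U) dot (t *: X x + Y x) (t *: X x + Y x) =
  t ^+ 2 * \int[mu]_(x in U) dot (X x) (X x) +
  (2 * t * \int[mu]_(x in U) dot (X x) (Y x) + \int[mu]_(x in U) dot (Y x) (Y x)).
Proof.
move=> LX LY; under eq_Rintegral do rewrite dotDZ//.
have iZ (a : R) Z : L2_field Z ->
    mu.-integrable U (EFin \o (fun x => a * dot (X x) (Z x))).
  by move=> LZ; exact: (integrableZl mU a (integrable_dot LX LZ)).
have iY := integrable_dot LY LY.
rewrite RintegralD ?RintegralD ?RintegralZl//;
  try exact: integrable_dot; try exact: iZ.
exact: (integrableD mU (iZ _ _ LY) iY).
Qed.

Lemma Rintegral_dotDZl X Y Z t : L2_field X -> L2_field Y -> L2_field Z ->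
  \int[mu]_(x in U) dot (t *: X x + Y x) (Z x) =
  t * \int[mu]_(x in U) dot (X x) (Z x) + \int[mu]_(x in U) dot (Y x) (Z x).
Proof.
move=> LX LY LZ; under eq_Rintegral do rewrite dotDZl.
have iX := integrable_dot LX LZ.
rewrite RintegralD ?RintegralZl//; last exact: integrable_dot.
exact: (integrableZl mU t iX).
Qed.

Lemma quadratic_ge0_le (A B C : R) : 0 <= A -> 0 <= C ->
  (forall t, 0 <= t ^+ 2 * A + (2 * t * B + C)) ->
  `|B| <= Num.sqrt A * Num.sqrt C.
Proof.
move=> A0 C0 H; rewrite -sqrtrM// -sqrtr_sqr ler_wsqrtr//.
have [A00|An0] := eqVneq A 0.
  have [->|B0] := eqVneq B 0; first by rewrite expr0n A00 mul0r.
  (* for A = 0 the polynomial is affine; at this t it takes the value -1 *)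
  have := H (- (C + 1) / (2 * B)).
  have -> : 2 * (- (C + 1) / (2 * B)) * B = - (C + 1) by field.
  rewrite A00 mulr0; lra.
have A1 : 0 < A by rewrite lt0r An0.
have := H (- B / A).
have -> : (- B / A) ^+ 2 * A + (2 * (- B / A) * B + C) = (A * C - B ^+ 2) / A by field.
by rewrite pmulr_lge0 ?invr_gt0// subr_ge0.
Qed.

Lemma cauchy_schwarz_field X Y : L2_field X -> L2_field Y ->
  `|\int[mu]_(x in U) dot (X x) (Y x)| <=
  Num.sqrt (\int[mu]_(x in U) dot (X x) (X x)) *
  Num.sqrt (\int[mu]_(x in U) dot (Y x) (Y x)).
Proof.
move=> LX LY; apply: quadratic_ge0_le.
- by apply: Rintegral_ge0 => x _; exact: dot_ge0.
- by apply: Rintegral_ge0 => x _; exact: dot_ge0.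
- move=> t; rewrite -Rintegral_dotDZ//.
  by apply: Rintegral_ge0 => x _; exact: dot_ge0.
Qed.

Lemma cauchy_schwarz f g : L2 U f -> L2 U g ->
  `|\int[mu]_(x in U) (f x * g x)| <=
  Num.sqrt (\int[mu]_(x in U) (f x ^+ 2)) *
  Num.sqrt (\int[mu]_(x in U) (g x ^+ 2)).
Proof.
move=> Lf Lg; have [_ if2] := Lf; have [_ ig2] := Lg; apply: quadratic_ge0_le.
- by apply: Rintegral_ge0 => x _; exact: sqr_ge0.
- by apply: Rintegral_ge0 => x _; exact: sqr_ge0.
- move=> t.
  have -> : t ^+ 2 * \int[mu]_(x in U) (f x ^+ 2) +
      (2 * t * \int[mu]_(x in U) (f x * g x) +
       \int[mu]_(x in U) (g x ^+ 2)) =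
      \int[mu]_(x in U) (t * f x + g x) ^+ 2.
    have i1 : mu.-integrable U (EFin \o (fun x => t ^+ 2 * f x ^+ 2)).
      exact: (integrableZl mU (t ^+ 2) if2).
    have i2 : mu.-integrable U (EFin \o (fun x => 2 * t * (f x * g x))).
      exact: (integrableZl mU (2 * t) (L2M Lf Lg)).
    rewrite -!RintegralZl//; last exact: L2M.
    rewrite -!RintegralD//; last exact: (integrableD mU i2 ig2).
    by apply: eq_Rintegral => x _; ring.
  by apply: Rintegral_ge0 => x _; exact: sqr_ge0.
Qed.

End square_integrable.

Lemma Rintegral_le_setT (R : realType) (n : nat) (U : set 'rV[R]_n)
    (g : 'rV[R]_n -> R) : measurable U ->
  (@lebesgue_rV R n).-integrable setT (EFin \o g) -> (forall x, 0 <= g x) ->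
  \int[lebesgue_rV n]_(x in U) g x <= \int[lebesgue_rV n]_x g x.
Proof.
move=> mU ig g0; rewrite Rintegral_mkcond; apply: le_Rintegral => //.
- rewrite -restrict_EFin; apply/(integrable_mkcond _ mU).
  exact: (integrableS measurableT mU _ ig).
- by move=> x _; rewrite patchE; case: ifP.
Qed.

(** * The Dirichlet energy on H^1_0 *)

Section dirichlet.
Context {R : realType} {n : nat}.
Local Notation V := 'rV[R]_n.
Local Notation mu := (@lebesgue_rV R n).
Implicit Types (U : set V) (phi psi w : V -> R) (v : (V -> R) * (V -> V)).

Lemma gradient_L2_field U phi : measurable U ->
  smooth phi -> bounded_support phi -> L2_field U (gradient phi).
Proof.
move=> mU sphi bphi i; rewrite (_ : (fun x => _) = partial i phi).
  apply: L2_continuous => //; last exact: bounded_support_partial.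
  by apply: smooth_continuous; exact: smooth_partial.
by apply/funext => x; rewrite mxE.
Qed.

Lemma gradient_lin (f g : V -> R) (a : R) x : smooth f -> smooth g ->
  gradient (a *: f + g) x = a *: gradient f x + gradient g x.
Proof. by move=> sf sg; apply/rowP => i; rewrite !mxE partial_lin. Qed.

Lemma gradient0 (x : V) : gradient (0 : V -> R) x = 0.
Proof. by apply/rowP => i; rewrite !mxE; exact: derive_cst. Qed.

Lemma H1_norm0 U : measurable U -> H1_norm U 0 = 0.
Proof.
move=> mU; have -> : H1_norm U 0 = Num.sqrt (0 + 0); last by rewrite addr0 sqrtr0.
congr (Num.sqrt (_ + _)); apply: Rintegral_eq0 => // x _; last exact: dot0l.
by rewrite -[X in X ^+ 2]/(0 : R) expr0n.
Qed.

Lemma H10_test U phi : open U -> test_function U phi -> H10 U (phi, gradient phi).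
Proof.
move=> oU tphi; have mU := open_measurable_rV oU.
have sphi := test_function_smooth tphi; have bphi := test_function_bounded tphi.
split.
  split=> /=.
  - by apply: L2_continuous => //; exact: smooth_continuous.
  - exact: gradient_L2_field.
  - move=> psi tpsi i.
    under eq_Rintegral do rewrite mulrC.
    have := integration_by_parts_test i oU tpsi sphi.
    move=> /(congr1 -%R); rewrite opprK => <-; congr (- _).
    by apply: eq_Rintegral => x _; rewrite mxE mulrC.
exists (fun=> phi); split=> //.
rewrite subrr H1_norm0//; exact: cvg_cst.
Qed.

Lemma H10_L2 U v : H10 U v -> L2 U v.1 /\ L2_field U v.2.
Proof. by case=> -[]. Qed.

(** The weak gradient formula holds by definition for test functions in U.  For an
    element of H^1_0(U) it extends to every smooth psi with bounded support, even if
    U cuts that support: it holds for the approximating test functions by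
    [integration_by_parts_test], and both sides are continuous for the H^1 norm by
    Cauchy-Schwarz. *)
Lemma H10_weak_gradient U v psi i : open U -> H10 U v ->
  smooth psi -> bounded_support psi ->
  \int[mu]_(x in U) (v.1 x * partial i psi x) =
  - \int[mu]_(x in U) (v.2 x 0 i * psi x).
Proof.
move=> oU Hv spsi bpsi; have mU := open_measurable_rV oU.
have [L1 L2v] := H10_L2 Hv.
have [_ [phi [tphi cphi]]] := Hv.
have Lp : L2 U psi by apply: L2_continuous => //; exact: smooth_continuous.
have Ldp : L2 U (partial i psi).
  apply: L2_continuous => //; last exact: bounded_support_partial.
  by apply: smooth_continuous; exact: smooth_partial.
apply/eqP; rewrite -addr_eq0; apply/eqP; set D := _ + _.
pose C := Num.sqrt (\int[mu]_(x in U) (partial i psi x ^+ 2)) +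
          Num.sqrt (\int[mu]_(x in U) (psi x ^+ 2)).
have DC j : `|D| <= H1_norm U (v - (phi j, gradient (phi j))) * C.
  have sphi := test_function_smooth (tphi j).
  have bphi := test_function_bounded (tphi j).
  pose h x := v.1 x - phi j x; pose g x := v.2 x - gradient (phi j) x.
  have Lphi : L2 U (phi j) by apply: L2_continuous => //; exact: smooth_continuous.
  have Lgphi : L2_field U (gradient (phi j)) by exact: gradient_L2_field.
  have Lh : L2 U h.
    rewrite (_ : h = (fun x => -1 * phi j x + v.1 x)); first exact: L2_lin.
    by apply/funext => x; rewrite /h; ring.
  have Lg : L2_field U g.
    rewrite (_ : g = (fun x => -1 *: gradient (phi j) x + v.2 x)).
      exact: L2_field_lin.
    by apply/funext => x; rewrite /g scaleN1r addrC.
  have -> : D = \int[mu]_(x in U) (h x * partial i psi x) +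
                \int[mu]_(x in U) (g x 0 i * psi x).
    have Eh : \int[mu]_(x in U) (h x * partial i psi x) =
        \int[mu]_(x in U) (v.1 x * partial i psi x) -
        \int[mu]_(x in U) (phi j x * partial i psi x).
      rewrite -RintegralB//; try exact: L2M.
      by apply: eq_Rintegral => x _; rewrite /h mulrBl.
    have Eg : \int[mu]_(x in U) (g x 0 i * psi x) =
        \int[mu]_(x in U) (v.2 x 0 i * psi x) -
        \int[mu]_(x in U) (gradient (phi j) x 0 i * psi x).
      rewrite -RintegralB//;
        [|exact: (L2M mU (L2v i) Lp)|exact: (L2M mU (Lgphi i) Lp)].
      by apply: eq_Rintegral => x _; rewrite /g !mxE mulrBl.
    rewrite Eh Eg (integration_by_parts_test i oU (tphi j) spsi) /D.
    rewrite (_ : \int[mu]_(x in U) (gradient (phi j) x 0 i * psi x) =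
      \int[mu]_(x in U) (partial i (phi j) x * psi x)); first by ring.
    by apply: eq_Rintegral => x _; rewrite mxE.
  apply: le_trans (ler_normD _ _) _; rewrite mulrDr.
  have I0 f : 0 <= \int[mu]_(x in U) (f x ^+ 2).
    by apply: Rintegral_ge0 => x _; exact: sqr_ge0.
  have J0 : 0 <= \int[mu]_(x in U) dot (g x) (g x).
    by apply: Rintegral_ge0 => x _; exact: dot_ge0.
  apply: lerD.
    apply: le_trans (cauchy_schwarz mU Lh Ldp) _.
    rewrite ler_wpM2r ?sqrtr_ge0// ler_wsqrtr//.
    by rewrite -[leRHS]/(\int[mu]_(x in U) (h x ^+ 2) +
      \int[mu]_(x in U) dot (g x) (g x)) lerDl.
  apply: le_trans (cauchy_schwarz mU (Lg i) Lp) _.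
  rewrite ler_wpM2r ?sqrtr_ge0// ler_wsqrtr//.
  rewrite -[leRHS]/(\int[mu]_(x in U) (h x ^+ 2) +
    \int[mu]_(x in U) dot (g x) (g x)).
  apply: (@le_trans _ _ (\int[mu]_(x in U) dot (g x) (g x))); last first.
    by rewrite lerDr.
  apply: le_Rintegral => //; [exact: (Lg i).2|exact: integrable_dot|].
  move=> x _; rewrite /dot (bigD1 i)//= -expr2 lerDl.
  by apply: sumr_ge0 => k _; rewrite -expr2 sqr_ge0.
have C0 : 0 <= C by rewrite addr_ge0 ?sqrtr_ge0.
have cC : H1_norm U (v - (phi j, gradient (phi j))) * C
    @[j --> \oo] --> (0 * C : R).
  exact: cvgMl.
apply/eqP; rewrite -normr_le0 -(mul0r C).
rewrite -(cvg_lim _ cC)//; apply: limr_ge; first by apply/cvg_ex; exists (0 * C).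
by near=> j; exact: DC.
Unshelve. all: by end_near. Qed.

Definition neg_laplacian w : V -> R := fun x => - \sum_i partial i (partial i w) x.

Lemma neg_laplacian_pairing U v w : open U -> H10 U v ->
  smooth w -> bounded_support w ->
  \int[mu]_(x in U) (neg_laplacian w x * v.1 x) =
  \int[mu]_(x in U) dot (gradient w x) (v.2 x).
Proof.
move=> oU Hv sw bw; have mU := open_measurable_rV oU.
have [L1 L2v] := H10_L2 Hv.
have sw1 i := smooth_partial i sw; have sw2 i := smooth_partial i (sw1 i).
have bw1 i := bounded_support_partial i bw.
have bw2 i := bounded_support_partial i (bw1 i).
have Lw2 i : L2 U (partial i (partial i w)).
  by apply: L2_continuous (bw2 i) => //; exact: smooth_continuous (sw2 i).
rewrite Rintegral_dot//; last exact: gradient_L2_field.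
transitivity (\int[mu]_(x in U) \sum_i (-1 * (v.1 x * partial i (partial i w) x))).
  apply: eq_Rintegral => x _; rewrite /neg_laplacian mulNr mulr_suml -sumrN.
  by apply: eq_bigr => i _; ring.
rewrite (integrable_Rsum mU _ _).2 => [|i]; last first.
  exact: (integrableZl mU (-1) (L2M mU L1 (Lw2 i))).
apply: eq_bigr => i _; rewrite RintegralZl//; last exact: L2M.
rewrite (H10_weak_gradient i oU Hv (sw1 i) (bw1 i)) mulN1r opprK.
by apply: eq_Rintegral => x _; rewrite mxE mulrC.
Qed.

(** With f the negative Laplacian of w, the energy is a square centred at the gradient
    of w; the whole computation of nu' and nu'' rests on this formula. *)
Lemma energyE U v w : open U -> H10 U v -> smooth w -> bounded_support w ->
  energy (neg_laplacian w) U v =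
  2^-1 * \int[mu]_(x in U)
    dot (v.2 x - gradient w x) (v.2 x - gradient w x) -
  2^-1 * \int[mu]_(x in U) dot (gradient w x) (gradient w x).
Proof.
move=> oU Hv sw bw; have mU := open_measurable_rV oU.
have [L1 L2v] := H10_L2 Hv.
have Lw := gradient_L2_field mU sw bw.
rewrite /energy neg_laplacian_pairing//.
have := Rintegral_dotDZ mU (-1) Lw L2v.
under eq_Rintegral do rewrite scaleN1r addrC.
by move=> ->; field.
Qed.

End dirichlet.

(** * Weakly null sequences from Bessel's inequality *)

Section dual.
Context {R : realType} {E : lmodType R}.
Variables (S : set E) (N : E -> R).

Lemma cont_dual_eq0 (L : E -> R) : cont_dual S N L -> S 0 -> L 0 = 0.
Proof.
by move=> [linL _] S0; have := linL 1 0 0 S0 S0; rewrite scaler0 addr0 mul1r; lra.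
Qed.

Lemma cont_dual0 : cont_dual S N 0.
Proof.
split=> [a v w _ _|]; first by rewrite -[RHS]/(a * 0 + 0) mulr0 addr0.
by exists 0 => v _; rewrite mul0r normr0.
Qed.

Lemma cont_dual_lin (L1 L2 : E -> R) (a : R) :
  cont_dual S N L1 -> cont_dual S N L2 -> cont_dual S N (a *: L1 + L2).
Proof.
move=> [lin1 [C1 LC1]] [lin2 [C2 LC2]].
have E1 v : (a *: L1 + L2) v = a * L1 v + L2 v by [].
split=> [b v w Sv Sw|]; first by rewrite !E1 lin1// lin2//; ring.
exists (`|a| * C1 + C2) => v Sv; rewrite E1 (le_trans (ler_normD _ _))//.
by rewrite normrM mulrDl lerD ?LC2// -mulrA ler_wpM2l ?LC1.
Qed.

Lemma cont_dual_norm_le (L : E -> R) (B : R) (v0 : E) : 0 <= B ->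
  S v0 -> N v0 <= 1 -> (forall v, S v -> `|L v| <= B * N v) ->
  `|cont_dual_norm S N L| <= B.
Proof.
move=> B0 Sv0 Nv0 LB.
have ubB : ubound [set `|L v| | v in [set v | S v /\ N v <= 1]] B.
  by move=> _ [v [Sv Nv] <-]; rewrite (le_trans (LB _ Sv))// ler_piMr.
have ne : [set `|L v| | v in [set v | S v /\ N v <= 1]] `|L v0| by exists v0.
rewrite ger0_norm; first by apply: ge_sup => //; exists `|L v0|.
apply: le_trans (normr_ge0 (L v0)) _; apply: ub_le_sup => //.
by exists B.
Qed.

End dual.

Section bessel.
Context {R : realType} {E : lmodType R}.
Variables (S : set E) (N : E -> R) (e : nat -> E) (M : R).

(** Bessel's inequality, for a single functional L: applied to the sum of the
    L(e_k) e_k over k < m, the bound |L| <= C N gives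
    A <= |C| sqrt (M A) with A the sum of the L(e_k)^2, hence A <= C^2 M for every m.
    The series converges and L(e_k) tends to 0. *)
Lemma bessel_weakly_null : 0 <= M -> (forall k, S (e k)) ->
  (forall (c : nat -> R) m, S (\sum_(k < m) c k *: e k)) ->
  (forall (c : nat -> R) m,
     `|N (\sum_(k < m) c k *: e k)| <= Num.sqrt (M * \sum_(k < m) c k ^+ 2)) ->
  weakly_null S N e.
Proof.
move=> M0 Se Ssum Nsum; split=> // L dL; have [linL [C LC]] := dL.
have L0 : L 0 = 0.
  by apply: cont_dual_eq0 dL _; have := Ssum (fun=> 0) 0%N; rewrite big_ord0.
have Lsum (c : nat -> R) m :
    L (\sum_(k < m) c k *: e k) = \sum_(k < m) c k * L (e k).
  elim: m => [|m IH]; first by rewrite !big_ord0.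
  rewrite !big_ord_recr/= [X in L X]addrC linL; [|exact: Se|exact: Ssum].
  by rewrite IH addrC.
pose A m := \sum_(k < m) L (e k) ^+ 2.
have A0 m : 0 <= A m by apply: sumr_ge0 => k _; exact: sqr_ge0.
have AM m : A m <= C ^+ 2 * M.
  have [->|An0] := eqVneq (A m) 0; first by rewrite mulr_ge0// sqr_ge0.
  have Ap : 0 < A m by rewrite lt0r An0 A0.
  have H1 : A m <= `|C| * Num.sqrt (M * A m).
    have := LC _ (Ssum (L \o e) m).
    rewrite (Lsum (L \o e)) (_ : \sum_(k < m) _ = A m); last first.
      by apply: eq_bigr => k _; rewrite expr2.
    rewrite ger0_norm// => /le_trans; apply.
    apply: le_trans (ler_norm _) _; rewrite normrM ler_wpM2l//.
  have : A m ^+ 2 <= (C ^+ 2 * M) * A m.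
    apply: (@le_trans _ _ ((`|C| * Num.sqrt (M * A m)) ^+ 2)).
      by rewrite ler_sqr ?nnegrE// mulr_ge0// sqrtr_ge0.
    by rewrite exprMn sqr_sqrtr ?mulr_ge0// real_normK ?num_real// mulrA.
  by rewrite expr2 ler_pM2r.
have cA : cvgn (series (fun k => L (e k) ^+ 2)).
  apply: nondecreasing_is_cvgn.
    by apply: nondecreasing_series => // *; exact: sqr_ge0.
  by exists (C ^+ 2 * M) => _ [m _ <-]; rewrite seriesEord; exact: AM.
have /cvgr0Pnorm_lt c0 := cvg_series_cvg_0 cA.
apply/cvgr0Pnorm_lt => d d0; have d20 : 0 < d ^+ 2 by rewrite exprn_gt0.
near=> k.
have : `|L (e k) ^+ 2| < d ^+ 2 by near: k; exact: c0.
by rewrite normrX ltr_sqr ?nnegrE// ltW.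
Unshelve. all: by end_near. Qed.

End bessel.

Section laplacian.
Context {R : realType} {n : nat}.
Local Notation V := 'rV[R]_n.
Local Notation mu := (@lebesgue_rV R n).

Lemma test_function_neg_laplacian U (w : V -> R) :
  test_function U w -> test_function U (neg_laplacian w).
Proof.
move=> tw; have -> : neg_laplacian w = (-1) *: (\sum_i partial i (partial i w)) + 0.
  apply/funext => x.
  by rewrite /neg_laplacian addr0 scaleN1r -[RHS]/(- _) fct_sumE.
apply: test_function_lin; last exact: test_function0.
apply: big_ind => [||i _]; first exact: test_function0.
  by move=> f g tf tg; rewrite -[f]scale1r; exact: test_function_lin.
by do 2 apply: test_function_partial.
Qed.

Lemma Hm1_neg_laplacian U (w : V -> R) : open U -> test_function U w ->
  Hm1 U (Hm1_of_fun U (neg_laplacian w)).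
Proof.
move=> oU tw; have mU := open_measurable_rV oU.
have sw := test_function_smooth tw; have bw := test_function_bounded tw.
have tl := test_function_neg_laplacian tw.
have Ll : L2 U (neg_laplacian w).
  apply: L2_continuous => //; last exact: test_function_bounded tl.
  exact: smooth_continuous (test_function_smooth tl).
split=> [a v1 v2 Hv1 Hv2|].
  have [L1 _] := H10_L2 Hv1; have [L2 _] := H10_L2 Hv2.
  rewrite /Hm1_of_fun -RintegralZl//; last exact: L2M.
  rewrite -RintegralD//; last 2 first.
    exact: (integrableZl mU a (L2M mU Ll L1)).
    exact: L2M.
  apply: eq_Rintegral => x _.
  by rewrite -[(a *: v1 + v2).1 x]/(a * v1.1 x + v2.1 x); ring.
exists (Num.sqrt (\int[mu]_(x in U) dot (gradient w x) (gradient w x))) => v Hv.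
rewrite /Hm1_of_fun neg_laplacian_pairing//; apply: cauchy_schwarz_field => //.
  exact: gradient_L2_field.
exact: (H10_L2 Hv).2.
Qed.

End laplacian.

Section orthogonal_sums.
Context {R : realType} {n : nat}.
Local Notation V := 'rV[R]_n.
Local Notation mu := (@lebesgue_rV R n).
Variables (w : nat -> V -> R) (K : nat -> set V).
Hypotheses (Kcl : forall k, closed (K k)).
Hypotheses (Kdisj : forall j k x, K j x -> K k x -> j = k).
Hypotheses (wK : forall k, vanishes_off (K k) (w k)).

Let s (c : nat -> R) m : V -> R := \sum_(k < m) c k *: w k.

Lemma test_function_sum U c m :
  (forall k, test_function U (w k)) -> test_function U (s c m).
Proof.
move=> tw; rewrite /s; elim: m => [|m IH].
  by rewrite big_ord0; exact: test_function0.
by rewrite big_ord_recr/= addrC; exact: test_function_lin.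
Qed.

Section test.
Variable U : set V.
Hypotheses (oU : open U) (tw : forall k, test_function U (w k)).

Let mU := open_measurable_rV oU.
Let sw k := test_function_smooth (tw k).
Let bw k := test_function_bounded (tw k).
Let ss c m : smooth (s c m) := test_function_smooth (test_function_sum c m tw).
Let bs c m : bounded_support (s c m) :=
  test_function_bounded (test_function_sum c m tw).

Lemma gradient_sumS c m x :
  gradient (s c m.+1) x = c m *: gradient (w m) x + gradient (s c m) x.
Proof. by rewrite {1}/s big_ord_recr/= addrC gradient_lin//; exact: ss. Qed.

Lemma gradient_sum_eq0 c m x : (forall k, (k < m)%N -> ~ K k x) ->
  gradient (s c m) x = 0.
Proof.
elim: m => [|m IH] Kx; first by rewrite /s big_ord0 gradient0.
rewrite gradient_sumS IH ?addr0 => [|k km]; last by apply: Kx; rewrite ltnW.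
rewrite (gradient_vanishes_off (@Kcl m) (@wK m)) ?scaler0//.
exact: Kx.
Qed.

(** Disjoint supports make the gradients pointwise orthogonal, so the cross term of
    the square disappears at each step of the sum. *)
Lemma Rintegral_gradient_sum c m (M : R) :
  (forall k, \int[mu]_(x in U) dot (gradient (w k) x) (gradient (w k) x) <= M) ->
  \int[mu]_(x in U) dot (gradient (s c m) x) (gradient (s c m) x) <=
  M * \sum_(k < m) c k ^+ 2.
Proof.
move=> wM; elim: m => [|m IH].
  rewrite big_ord0 mulr0 Rintegral_eq0// => x _.
  by rewrite gradient_sum_eq0// dot0l.
under eq_Rintegral do rewrite gradient_sumS.
rewrite Rintegral_dotDZ//; try exact: gradient_L2_field.
rewrite [X in 2 * c m * X]Rintegral_eq0 ?mulr0 ?add0r => [|//|x _]; last first.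
  have [Kx|Kx] := pselect (K m x).
    rewrite gradient_sum_eq0 => [|k km Kk]; first by rewrite dotC dot0l.
    by move: km; rewrite (Kdisj Kk Kx) ltnn.
  by rewrite (gradient_vanishes_off (@Kcl m) (@wK m))// dot0l.
by rewrite big_ord_recr/= mulrDr addrC lerD// mulrC ler_wpM2r ?sqr_ge0.
Qed.

Lemma weakly_null_H10 (M : R) :
  (forall k, \int[mu]_(x in U) dot (gradient (w k) x) (gradient (w k) x) <= M) ->
  weakly_null (H10 U) (H10_norm U) (fun k => (w k, gradient (w k))).
Proof.
move=> wM.
have sE (c : nat -> R) m :
    \sum_(k < m) c k *: ((w k, gradient (w k)) : (V -> R) * (V -> V)) =
    (s c m, gradient (s c m)).
  elim: m => [|m IH].
    rewrite big_ord0 /s big_ord0; congr (_, _); apply/funext => x.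
    by rewrite gradient0.
  rewrite big_ord_recr/= IH; congr (_, _); first by rewrite /s big_ord_recr.
  by apply/funext => x; rewrite gradient_sumS addrC.
have M0 : 0 <= M.
  by apply: le_trans (wM 0%N); apply: Rintegral_ge0 => x _; exact: dot_ge0.
apply: (@bessel_weakly_null _ _ _ _ _ M) => // [k|c m|c m].
- exact: H10_test.
- by rewrite sE; apply: H10_test => //; exact: test_function_sum.
- rewrite sE /H10_norm ger0_norm ?sqrtr_ge0// ler_wsqrtr//.
  exact: Rintegral_gradient_sum.
Qed.

(** On H^1_0(U) the functional attached to the negative Laplacian of w_k is the scalar
    product with the gradient of w_k; the norm of a linear combination is therefore
    controlled by the same orthogonal sum as in H^1_0(U). *)
Lemma weakly_null_Hm1 (M : R) :
  (forall k, \int[mu]_(x in U) dot (gradient (w k) x) (gradient (w k) x) <= M) ->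
  weakly_null (Hm1 U) (Hm1_norm U) (fun k => Hm1_of_fun U (neg_laplacian (w k))).
Proof.
move=> wM.
pose F k := Hm1_of_fun U (neg_laplacian (w k)).
have FE (c : nat -> R) m v : H10 U v -> (\sum_(k < m) c k *: F k) v =
    \int[mu]_(x in U) dot (gradient (s c m) x) (v.2 x).
  move=> Hv; elim: m => [|m IH].
    by rewrite big_ord0 Rintegral_eq0// => x _; rewrite gradient_sum_eq0// dot0l.
  rewrite big_ord_recr/=; under eq_Rintegral do rewrite gradient_sumS.
  have [_ Lv] := H10_L2 Hv.
  rewrite Rintegral_dotDZl//; try exact: gradient_L2_field.
  by rewrite -neg_laplacian_pairing// -IH addrC.
have M0 : 0 <= M.
  by apply: le_trans (wM 0%N); apply: Rintegral_ge0 => x _; exact: dot_ge0.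
apply: (@bessel_weakly_null _ _ _ _ _ M) => // [k|c m|c m].
- exact: Hm1_neg_laplacian.
- elim: m => [|m IH]; first by rewrite big_ord0; exact: cont_dual0.
  rewrite big_ord_recr/= addrC.
  by apply: cont_dual_lin => //; exact: Hm1_neg_laplacian.
- have H0 := H10_test oU (test_function0 U).
  apply: (@le_trans _ _ (Num.sqrt
      (\int[mu]_(x in U) dot (gradient (s c m) x) (gradient (s c m) x)))).
    apply: (cont_dual_norm_le _ H0); first exact: sqrtr_ge0.
      rewrite /H10_norm Rintegral_eq0 ?sqrtr0// => x _.
      by rewrite /= gradient0 dot0l.
    move=> v Hv; rewrite FE//; apply: cauchy_schwarz_field => //.
      exact: gradient_L2_field.
    exact: (H10_L2 Hv).2.
  by rewrite ler_wsqrtr//; exact: Rintegral_gradient_sum.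
Qed.

End test.
End orthogonal_sums.

(** * Bounds on nu' and nu'' *)

Section limits.
Context {R : realType}.
Local Open Scope ereal_scope.

Lemma limn_einf_ge (u : (\bar R)^nat) (a : \bar R) (N : nat) :
  (forall k, (N <= k)%N -> a <= u k) -> a <= limn_einf u.
Proof.
move=> au; rewrite limn_einf_lim (cvg_lim _ (@cvg_einfs_sup _ u))//.
apply: (@le_trans _ _ (einfs u N)).
  by apply: le_ereal_inf_tmp => _ [k /= Nk <-]; exact: au.
by apply: ereal_sup_ubound; exists N.
Qed.

Lemma limn_esup_le (u : (\bar R)^nat) (a : \bar R) (N : nat) :
  (forall k, (N <= k)%N -> u k <= a) -> limn_esup u <= a.
Proof.
move=> au; rewrite limn_esup_lim (cvg_lim _ (@cvg_esups_inf _ u))//.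
apply: (@le_trans _ _ (esups u N)).
  by apply: ereal_inf_lbound; exists N.
by apply: ge_ereal_sup => _ [k /= Nk <-]; exact: au.
Qed.

End limits.

Section nu.
Context {R : realType} {n : nat}.
Local Notation V := 'rV[R]_n.
Local Notation mu := (@lebesgue_rV R n).
Implicit Types (U : set V) (f : nat -> V -> R).

Lemma nu''_le_nu' f U : (nu'' f U <= nu' f U)%E.
Proof.
rewrite leeN2; apply: le_ereal_inf_tmp => _ [v wv <-].
apply: le_trans (limn_einf_sup _).
by apply: ereal_inf_lbound; exists v.
Qed.

Lemma weakly_null0 U : open U -> weakly_null (H10 U) (H10_norm U) (fun=> 0).
Proof.
move=> oU; have H0 : H10 U (0 : (V -> R) * (V -> V)).
  have -> : (0 : (V -> R) * (V -> V)) = (0, gradient (0 : V -> R)).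
    by congr (_, _); apply/funext => x; rewrite gradient0.
  exact/H10_test/test_function0.
by split=> // L dL; rewrite (cont_dual_eq0 dL H0); exact: cvg_cst.
Qed.

Lemma nu''_ge0 f U : open U -> (0 <= nu'' f U)%E.
Proof.
move=> oU; have mU := open_measurable_rV oU.
rewrite /nu'' leeNr oppe0; apply: (@le_trans _ _
    (limn_esup (fun k => (energy (f k) U 0)%:E))).
  by apply: ereal_inf_lbound; exists (fun=> 0) => //; exact: weakly_null0.
apply: (limn_esup_le (N := 0)) => k _.
rewrite lee_fin /energy !Rintegral_eq0 ?mulr0 ?subr0// => x _; last exact: dot0l.
by rewrite -[X in _ * X]/(0 : R) mulr0.
Qed.

End nu.

Section concentration.
Context {R : realType} {n : nat}.
Local Notation V := 'rV[R]_n.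
Local Notation mu := (@lebesgue_rV R n).
Variables (w : nat -> V -> R) (K : nat -> set V).
Hypotheses (sw : forall k, smooth (w k)).
Hypotheses (Kco : forall k, compact (K k)).
Hypotheses (Kdisj : forall j k x, K j x -> K k x -> j = k).
Hypotheses (wK : forall k, vanishes_off (K k) (w k)).
Hypotheses (wnorm : forall k,
  \int[mu]_x dot (gradient (w k) x) (gradient (w k) x) = 2).
Implicit Type U : set V.

Let f k := neg_laplacian (w k).

Let Kcl k : closed (K k).
Proof. by apply: compact_closed => //; exact: norm_hausdorff. Qed.

Lemma test_function_bump U k : K k `<=` U -> test_function U (w k).
Proof. by move=> KU; apply/test_functionP; split=> //; exists (K k). Qed.

Let tw k : test_function setT (w k). Proof. exact: test_function_bump. Qed.

Let bw k := test_function_bounded (tw k).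

Lemma gradient_bump_le U k : measurable U ->
  \int[mu]_(x in U) dot (gradient (w k) x) (gradient (w k) x) <= 2.
Proof.
move=> mU; rewrite -(wnorm k); apply: Rintegral_le_setT => //.
  by apply: integrable_dot => //; exact: gradient_L2_field.
by move=> x; exact: dot_ge0.
Qed.

Lemma gradient_bump_eq U k : K k `<=` U ->
  \int[mu]_(x in U) dot (gradient (w k) x) (gradient (w k) x) = 2.
Proof.
move=> KU; rewrite -(wnorm k) Rintegral_mkcond; apply: eq_Rintegral => x _.
rewrite patchE; case: ifPn => // /negP xU.
by rewrite (gradient_vanishes_off (@Kcl k) (@wK k)) ?dot0l// => /KU/mem_set.
Qed.

(** The energy is at least minus half the square norm of the gradient of w_k on U,
    that is at least -1, whatever the position of U relative to the supports. *)
Lemma nu'_bumps_le1 U : open U -> (nu' f U <= 1)%E.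
Proof.
move=> oU; have mU := open_measurable_rV oU.
rewrite /nu' leeNl; apply: le_ereal_inf_tmp => _ [v [Sv _] <-].
apply: (limn_einf_ge (N := 0)) => k _.
rewrite -EFinN lee_fin energyE//.
have := gradient_bump_le k mU.
have : 0 <= \int[mu]_(x in U)
    dot ((v k).2 x - gradient (w k) x) ((v k).2 x - gradient (w k) x).
  by apply: Rintegral_ge0 => x _; exact: dot_ge0.
by lra.
Qed.

(** Once f_k vanishes on U, the energy is the nonnegative Dirichlet integral. *)
Lemma nu'_bumps_le0 U N : open U -> (forall k, (N <= k)%N -> K k `&` U = set0) ->
  (nu' f U <= 0)%E.
Proof.
move=> oU KU; have mU := open_measurable_rV oU.
rewrite /nu' leeNl oppe0; apply: le_ereal_inf_tmp => _ [v [Sv _] <-].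
apply: (limn_einf_ge (N := N)) => k Nk.
rewrite lee_fin /energy [X in _ - X]Rintegral_eq0 => [|//|x Ux].
  rewrite subr0 mulr_ge0// ?invr_ge0//.
  by apply: Rintegral_ge0 => x _; exact: dot_ge0.
rewrite /f /neg_laplacian big1 ?oppr0 ?mul0r// => i _.
have vK := partial_vanishes_off i (@Kcl k)
  (partial_vanishes_off i (@Kcl k) (@wK k)).
by rewrite vK// => Kx; have : (K k `&` U) x by []; rewrite KU.
Qed.

(** The sequence w_k is admissible in U and attains the minimal energy -1 as soon as
    the support of w_k lies in U; its first N terms are replaced by 0. *)
Lemma nu''_bumps_ge1 U N : open U -> (forall k, (N <= k)%N -> K k `<=` U) ->
  (1 <= nu'' f U)%E.
Proof.
move=> oU KU; have mU := open_measurable_rV oU.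
pose w' k : V -> R := if (N <= k)%N then w k else 0.
have w'w k : (N <= k)%N -> w' k = w k by move=> Nk; rewrite /w' Nk.
have w'K k : vanishes_off (K k) (w' k).
  by rewrite /w'; case: ifP => // _; exact: wK.
have tw' k : test_function U (w' k).
  rewrite /w'; case: ifP => [/KU|_]; first exact: test_function_bump.
  exact: test_function0.
have w'2 k : \int[mu]_(x in U) dot (gradient (w' k) x) (gradient (w' k) x) <= 2.
  rewrite /w'; case: ifP => _; first exact: gradient_bump_le.
  by rewrite Rintegral_eq0// => x _; rewrite gradient0 dot0l.
have wn := weakly_null_H10 Kcl Kdisj w'K oU tw' w'2.
rewrite /nu'' leeNr; apply: (@le_trans _ _
    (limn_esup (fun k => (energy (f k) U (w' k, gradient (w' k)))%:E))).
  by apply: ereal_inf_lbound; exists (fun k => (w' k, gradient (w' k))).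
apply: (limn_esup_le (N := N)) => k Nk.
have Hk : H10 U (w' k, gradient (w' k)) by exact: H10_test.
rewrite -EFinN lee_fin energyE// gradient_bump_eq; last exact: KU.
rewrite Rintegral_eq0 => [|//|x _]; first by lra.
by rewrite w'w//= subrr dot0l.
Qed.

Lemma Linfty_bumps U k : Linfty U (f k).
Proof.
have tf := test_function_neg_laplacian (tw k).
have cf := smooth_continuous (test_function_smooth tf).
split; first exact: continuous_measurable_rV.
have [M fM] := continuous_bounded cf (test_function_bounded tf).
by exists M; apply: aeW => x _; exact: fM.
Qed.

Lemma weakly_null_bumps U : open U -> (forall k, K k `<=` U) ->
  weakly_null (Hm1 U) (Hm1_norm U) (fun k => Hm1_of_fun U (f k)).
Proof.
move=> oU KU; have tU k := test_function_bump (KU k).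
apply: (weakly_null_Hm1 Kcl Kdisj wK oU tU) => k.
exact: gradient_bump_le (open_measurable_rV oU).
Qed.

End concentration.

(** * Normalized bumps in boxes accumulating at a boundary point *)

Section bumps.
Context {R : realType} {n : nat}.
Local Notation V := 'rV[R]_n.
Local Notation mu := (@lebesgue_rV R n).

Lemma nbhs_box (x : V) (A : set V) : nbhs x A -> exists2 r, 0 < r & box x r `<=` A.
Proof.
move=> /nbhs_ballP[e /= e0 eA]; exists (e / 2); first by rewrite divr_gt0.
move=> y xy; apply: eA; apply/rV_ballP; split=> // i.
by rewrite distrC (le_lt_trans (xy i))// ltr_pdivrMr// ltr_pMr// ltr1n.
Qed.

Lemma lebesgue_rV_box_gt0 (c : V) r : 0 < r -> (0 < mu (box c r))%E.
Proof.
move=> r0; rewrite lebesgue_rV_boxE ?ltW// lte_fin.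
by apply: prodr_gt0 => i _; rewrite addr_gt0.
Qed.

Lemma Rintegral_gt0 (g : V -> R) (y : V) : continuous g -> bounded_support g ->
  (forall x, 0 <= g x) -> 0 < g y -> 0 < \int[mu]_x g x.
Proof.
move=> cg bg g0 gy.
have : nbhs y [set x | g y / 2 < g x].
  have : nbhs (g y) [set z | g y / 2 < z].
    by apply: lt_nbhsr; rewrite ltr_pdivrMr// ltr_pMr// ltr1n.
  exact: cg.
move=> /nbhs_box[r r0 rg].
have mB := @measurable_box R n y r.
have ig := integrable_continuous measurableT cg bg.
have : g y / 2 * fine (mu (box y r)) <= \int[mu]_(x in box y r) g x.
  rewrite -Rintegral_cst//; apply: le_Rintegral => //.
  - apply/integrableP; split; first exact: measurable_cst.
    rewrite integral_cst//= lte_mul_pinfty//.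
    exact: lebesgue_rV_box_lty.
  - exact: (integrableS measurableT mB _ ig).
  - by move=> x /rg/ltW.
have := Rintegral_le_setT mB ig g0.
have : 0 < fine (mu (box y r)).
  by apply: fine_gt0; rewrite lebesgue_rV_box_gt0// lebesgue_rV_box_lty.
move=> h1 h2 h3; apply: lt_le_trans h2; apply: lt_le_trans h3.
by rewrite mulr_gt0// divr_gt0.
Qed.

(** A smooth function with zero partial derivative in some direction is constant on
    the lines of that direction, which leave the box. *)
Lemma partial_neq0 (f : V -> R) (i : 'I_n) (c : V) r : 0 < r ->
  smooth f -> vanishes_off (box c r) f -> 0 < f c ->
  exists y, partial i f y != 0.
Proof.
move=> r0 sf fB fc; apply: contrapT => /forallNP H.
have d0 t : is_derive t (1 : R) (fun s : R => f (s *: delta_mx 0 i + c)) 0.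
  have df := smooth_is_derive i (t *: delta_mx 0 i + c) sf.
  have /negP := H (t *: delta_mx 0 i + c); rewrite negbK => /eqP E.
  by move: df; rewrite E => /is_derive_line.
have := is_derive_0_is_cst (r + r) 0 d0; rewrite scale0r add0r fB => [e|].
  by move: fc; rewrite -e ltxx.
move=> /(_ i); rewrite !mxE !eqxx/= mulr1 addrK gtr0_norm ?addr_gt0//.
by rewrite leNgt ltrDl r0.
Qed.

Lemma exists_normalized_bump (c : V) (r : R) : (0 < n)%N -> 0 < r ->
  exists w, [/\ smooth w, vanishes_off (box c r) w &
    \int[mu]_x dot (gradient w x) (gradient w x) = 2].
Proof.
move=> n0 r0; have [f [sf fB fc]] := exists_bump c r0.
have bf : bounded_support f.
  have [s Bs] := compact_sub_box (@compact_box _ _ c r).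
  by exists s => x xs; apply: fB => /Bs.
have [y fy] := partial_neq0 (Ordinal n0) r0 sf fB fc.
pose g x := dot (gradient f x) (gradient f x).
have gE x : g x = \sum_i (partial i f x * partial i f x).
  by apply: eq_bigr => i _; rewrite mxE.
have I0 : 0 < \int[mu]_x g x.
  apply: (Rintegral_gt0 (y := y)).
  - rewrite (_ : g = \sum_i (partial i f * partial i f)).
      apply: smooth_continuous; apply: big_ind; first exact: smooth_cst.
        exact: smoothD.
      by move=> i _; apply: smoothM; exact: smooth_partial.
    by apply/funext => x; rewrite gE fct_sumE.
  - have [s fs] := bf; exists s => x xs; rewrite gE big1// => i _.
    by rewrite (partial_vanishes_off i (@closed_box _ _ 0 s) fs)// mul0r.
  - by move=> x; exact: dot_ge0.
  - rewrite gE (bigD1 (Ordinal n0))//= ltr_pwDl ?sumr_ge0//.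
      by rewrite -expr2 exprn_even_gt0.
    by move=> i _; rewrite -expr2 sqr_ge0.
pose a := Num.sqrt (2 / \int[mu]_x g x).
exists (a *: f); split.
- exact: smoothZ.
- by move=> x /fB fx; rewrite -[LHS]/(a * f x) fx mulr0.
- have Lf := gradient_L2_field measurableT sf bf.
  have gaf x : gradient (a *: f) x = a *: gradient f x.
    rewrite -[a *: f]addr0 (gradient_lin a x sf (@smooth_cst _ _ 0)).
    by rewrite gradient0 addr0.
  transitivity (\int[mu]_x (a ^+ 2 * g x)).
    apply: eq_Rintegral => x _; rewrite gaf /g /dot mulr_sumr.
    by apply: eq_bigr => i _; rewrite !mxE; ring.
  rewrite RintegralZl//; last exact: integrable_dot.
  by rewrite sqr_sqrtr ?divr_ge0 ?(ltW I0)// divfK// gt_eqF.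
Qed.

(** Since x0 is adherent to U0 but not in it, U0 contains a box as close to x0 as
    desired, and this box keeps a positive distance to x0. *)
Lemma exists_box_step (U0 : set V) (x0 : V) : open U0 -> closure U0 x0 -> ~ U0 x0 ->
  exists p : R -> V * R * R, forall e, 0 < e ->
    [/\ 0 < (p e).1.2, 0 < (p e).2 <= e / 2,
        box (p e).1.1 (p e).1.2 `<=` U0 `&` ball x0 e &
        box (p e).1.1 (p e).1.2 `&` ball x0 (p e).2 = set0].
Proof.
move=> oU0 cx0 Ux0.
suff H e : exists p : V * R * R, 0 < e ->
    [/\ 0 < p.1.2, 0 < p.2 <= e / 2, box p.1.1 p.1.2 `<=` U0 `&` ball x0 e &
        box p.1.1 p.1.2 `&` ball x0 p.2 = set0].
  by have [p Hp] := choice H; exists p => e; exact: Hp.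
have [e0|e0] := ltP 0 e; last by exists ((0, 0), 0).
have [c [Uc ec]] := cx0 _ (nbhsx_ballx x0 _ e0).
have [r r0 rU] : exists2 r, 0 < r & box c r `<=` U0 `&` ball x0 e.
  apply: nbhs_box; apply: filterI; first exact: open_nbhs_nbhs.
  by apply: open_nbhs_nbhs; split=> //; exact: ball_open.
have : nbhs x0 (~` box c r).
  apply: open_nbhs_nbhs; split; first exact/closed_openC/closed_box.
  by move=> /rU[].
move=> /nbhs_ballP[d /= d0 dB].
exists ((c, r), Num.min d (e / 2)) => _; split=> //=.
  by rewrite lt_min d0 divr_gt0// ge_min lexx orbT.
apply/seteqP; split=> // y [yB yd]; apply: (dB y) => //.
by apply: le_ball yd; rewrite ge_min lexx.
Qed.

(** Iterating [exists_box_step], each box lies in a ball around x0 that the earlier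
    boxes avoid. *)
Lemma exists_boxes (U0 : set V) (x0 : V) : open U0 -> closure U0 x0 -> ~ U0 x0 ->
  exists c : nat -> V, exists r : nat -> R,
    [/\ forall k, 0 < r k, forall k, box (c k) (r k) `<=` U0,
        forall j k x, box (c j) (r j) x -> box (c k) (r k) x -> j = k &
        forall A, nbhs x0 A -> exists N, forall k, (N <= k)%N ->
          box (c k) (r k) `<=` A].
Proof.
move=> oU0 cx0 Ux0; have [p Hp] := exists_box_step oU0 cx0 Ux0.
pose e k := iter k (fun d => (p d).2) 1.
have e0 k : 0 < e k by elim: k => [//|k /Hp[_ /andP[]]].
have eS k : e k.+1 <= e k / 2 by have [_ /andP[]] := Hp _ (e0 k).
have ele j k : (j <= k)%N -> e k <= e j.
  move=> /subnK <-; elim: (k - j)%N => [//|m IH]; apply: le_trans IH.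
  by rewrite addSn (le_trans (eS _))// ler_pdivrMr// ler_peMr ?ler1n// ltW.
(* halving at each step is more than enough for this bound, which tends to 0 *)
have eh k : e k <= k.+1%:R^-1.
  elim: k => [|k IH]; first by rewrite invr1.
  apply: le_trans (eS k) _; apply: (@le_trans _ _ (k.+1%:R^-1 / 2)).
    by rewrite ler_pM2r// invr_gt0.
  by rewrite -invfM lef_pV2 ?posrE ?mulr_gt0 ?ltr0n// -natrM ler_nat; lia.
exists (fun k => (p (e k)).1.1), (fun k => (p (e k)).1.2).
have disj j k x : (j < k)%N -> box (p (e j)).1.1 (p (e j)).1.2 x ->
    ~ box (p (e k)).1.1 (p (e k)).1.2 x.
  move=> jk jx kx.
  have [_ _ _ E] := Hp _ (e0 j); have [_ _ /(_ _ kx)[_ xe] _] := Hp _ (e0 k).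
  have : set0 x by rewrite -E; split=> //; apply: le_ball xe; exact: (ele j.+1 k).
  by [].
split.
- by move=> k; have [] := Hp _ (e0 k).
- by move=> k x; have [_ _ H _] := Hp _ (e0 k); move=> /H[].
- move=> j k x jx kx; case: (ltngtP j k) => // jk; exfalso.
    exact: disj jk jx kx.
  exact: disj jk kx jx.
- move=> A /nbhs_ballP[d /= d0 dA].
  exists (Num.truncn d^-1) => k Nk.
  have [_ _ H _] := Hp _ (e0 k).
  apply: subset_trans H _; apply: subset_trans (@subIsetr _ _ _) _.
  apply: subset_trans dA => x; apply: le_ball.
  apply: le_trans (eh k) _; rewrite invf_ple ?posrE ?ltr0n//.
  apply: ltW; apply: (lt_le_trans (Num.Theory.truncnS_gt _)).
  by rewrite ler_nat.
Qed.

End bumps.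

(** * Point masses and rich families *)

Section point_mass.
Context {R : realType} {n : nat}.
Local Notation V := 'rV[R]_n.

(** If x0 is in U, a small ball around x0 already gives the maximal value 1; if x0 is
    not in U, no set relatively compact in U has x0 in its closure. *)
Lemma inner_sup_dirac (m : set V -> \bar R) (x0 : V) (U : set V) : open U ->
  (forall A, open A -> A `<=` U -> (m A <= 1)%E) ->
  (forall A, open A -> A `<=` U -> A x0 -> m A = 1%E) ->
  (forall A, open A -> A `<=` U -> ~ closure A x0 -> m A = 0%E) ->
  inner_sup m U = \d_x0 U.
Proof.
move=> oU m1 mx m0; rewrite diracE.
have sub A : relcompact_in A U -> A `<=` U.
  by move=> [_ AU]; apply: subset_trans AU; exact: subset_closure.
have [/set_mem Ux|/negP xU] := boolP (x0 \in U).
  apply/eqP; rewrite eq_le; apply/andP; split.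
    apply: ge_ereal_sup => _ [A [oA cA] <-].
    by apply: m1 => //; exact: sub.
  have [r r0 rU] := nbhs_box (open_nbhs_nbhs (conj oU Ux)).
  have bB : ball x0 r `<=` box x0 r.
    by move=> y /rV_ballP[_ H] i; rewrite distrC ltW.
  have cB : closure (ball x0 r) `<=` box x0 r.
    rewrite [X in _ `<=` X](closure_id (box x0 r)).1; last exact: closed_box.
    exact: closure_subset.
  have oB : open (ball x0 r) by exact: ball_open.
  apply: ereal_sup_ubound; exists (ball x0 r).
    split=> //; split; last exact: subset_trans rU.
    by apply: subclosed_compact (@compact_box _ _ x0 r) cB; exact: closed_closure.
  rewrite mx//; first by exact: subset_trans (subset_trans bB rU).
  exact: ballxx.
have xU' : ~ U x0 by move=> /mem_set.
apply/eqP; rewrite eq_le; apply/andP; split.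
  apply: ge_ereal_sup => _ [A [oA cA] <-].
  by rewrite m0//; [exact: sub|move=> /cA.2].
apply: ereal_sup_ubound; exists set0.
  split; first exact: open0.
  by split; rewrite closure0//; exact: compact0.
by rewrite m0// closure0.
Qed.

(** In an increasing family as in the definition of richness, x0 lies on the boundary
    of at most one member: if it is adherent to U_s then it belongs to U_t for all
    t > s. *)
Lemma rich_off_point (Omega : set V) (C : set (set V)) (x0 : V) :
  (forall U, C U -> open U /\ U `<=` Omega) ->
  (forall U, open U -> U `<=` Omega -> U x0 -> C U) ->
  (forall U, open U -> U `<=` Omega -> ~ closure U x0 -> C U) ->
  rich Omega C.
Proof.
move=> CO Cin Cout; split=> // Ut oU cU.
set B := [set t | _].
have Bx (t : R) : B t -> closure (Ut t) x0 /\ ~ Ut t x0.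
  move=> [t01 CN]; have [oUt sUt] := oU _ t01; split.
    by apply: contrapT => ?; apply: CN; exact: Cout.
  by move=> ?; apply: CN; exact: Cin.
have lt s t : B s -> B t -> ~ s < t.
  move=> Bs Bt st; have [_ H] := cU _ _ Bs.1 Bt.1 st.
  by apply: (Bx _ Bt).2; apply: H; exact: (Bx _ Bs).1.
have [[s Bs]|B0] := pselect (exists s, B s); last first.
  rewrite (_ : B = set0); first exact: countable0.
  by apply/seteqP; split=> // t Bt; apply: B0; exists t.
apply: (@sub_countable _ _ _ [set s]); last exact: countable1.
apply: subset_card_le => t Bt /=.
by case: (ltgtP t s) => // ts; exfalso; [exact: lt ts|exact: lt ts].
Qed.

End point_mass.

Theorem proposition3p7 (R : realType) (n : nat) (Omega U0 : set 'rV[R]_n)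
    (x0 : 'rV[R]_n) :
  (2 <= n)%N ->
  open Omega -> bounded_set Omega ->
  open U0 -> relcompact_in U0 Omega ->
  (closure U0 `\` interior U0) x0 ->
  exists f : nat -> 'rV[R]_n -> R,
    (forall k, Linfty Omega (f k)) /\
    weakly_null (Hm1 Omega) (Hm1_norm Omega)
      (fun k => Hm1_of_fun Omega (f k)) /\
    (* (a) *)
    (forall U, open U -> U `<=` Omega -> ~ closure U x0 ->
       nu' f U = 0%E /\ nu'' f U = 0%E) /\
    (* (b) *)
    (forall U, open U -> U `<=` Omega -> U x0 ->
       nu' f U = 1%E /\ nu'' f U = 1%E) /\
    (* (c) *)
    (nu' f U0 = 1%E /\ nu'' f U0 = 1%E) /\
    rich Omega
      [set U | [/\ open U, U `<=` Omega & nu' f U = nu'' f U]] /\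
    (forall U, open U -> U `<=` Omega ->
       inner_sup (nu' f) U = inner_sup (nu'' f) U) /\
    (* (d) *)
    (forall U, open U -> U `<=` Omega ->
       inner_sup (nu' f) U = \d_x0 U) /\
    inner_sup (nu' f) U0 = 0%E /\
    (0 < 1 :> \bar R)%E /\
    nu'' f U0 = 1%E /\ nu' f U0 = nu'' f U0.
Proof.
move=> n2 oO _ oU0 [_ U0O] [cx0 Ux0'].
have {Ux0'}Ux0 : ~ U0 x0.
  by move=> /(conj oU0)/open_nbhs_nbhs.
have {}U0O : U0 `<=` Omega by apply: subset_trans U0O; exact: subset_closure.
have [c [r [r0 BU0 Bdisj Bx0]]] := exists_boxes oU0 cx0 Ux0.
have /choice[w Hw] k := exists_normalized_bump (c k) (ltnW n2) (r0 k).
pose K k := box (c k) (r k).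
have sw k : smooth (w k) by have [] := Hw k.
have wK k : vanishes_off (K k) (w k) by have [] := Hw k.
have w2 k :
    \int[@lebesgue_rV R n]_x dot (gradient (w k) x) (gradient (w k) x) = 2.
  by have [] := Hw k.
have Kco k : compact (K k) by exact: compact_box.
have nu1 N U : open U -> (forall k, (N <= k)%N -> K k `<=` U) ->
    nu' (fun k => neg_laplacian (w k)) U = 1%E /\
    nu'' (fun k => neg_laplacian (w k)) U = 1%E.
  move=> oU KU.
  have le1 := nu'_bumps_le1 sw Kco wK w2 oU.
  have ge1 := nu''_bumps_ge1 sw Kco Bdisj wK w2 oU KU.
  have le := nu''_le_nu' (fun k => neg_laplacian (w k)) U.
  by split; apply/eqP;
    rewrite eq_le ?le1 ?ge1 ?(le_trans le le1) ?(le_trans ge1 le).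
pose f k := neg_laplacian (w k); exists f.
have a U : open U -> ~ closure U x0 -> nu' f U = 0%E /\ nu'' f U = 0%E.
  move=> oU xU.
  have [N KN] : exists N, forall k, (N <= k)%N -> K k `<=` ~` closure U.
    apply: Bx0; apply: open_nbhs_nbhs; split=> //.
    by apply: closed_openC; exact: closed_closure.
  have le0 : (nu' f U <= 0)%E.
    apply: (nu'_bumps_le0 Kco wK (N := N)) => // k Nk.
    apply/seteqP; split=> // y [Ky Uy].
    by apply: (KN k Nk y Ky); exact: subset_closure.
  have ge0 := nu''_ge0 f oU.
  have le := nu''_le_nu' f U.
  by split; apply/eqP;
    rewrite eq_le ?le0 ?ge0 ?(le_trans le le0) ?(le_trans ge0 le).
have b U : open U -> U x0 -> nu' f U = 1%E /\ nu'' f U = 1%E.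
  move=> oU Ux; have [N KN] := Bx0 U (open_nbhs_nbhs (conj oU Ux)).
  exact: nu1 KN.
have c1 : nu' f U0 = 1%E /\ nu'' f U0 = 1%E.
  exact (nu1 0%N U0 oU0 (fun k _ => BU0 k)).
have le1 U : open U -> (nu' f U <= 1)%E.
  by move=> oU; exact: (nu'_bumps_le1 sw Kco wK w2 oU).
have d' U : open U -> inner_sup (nu' f) U = \d_x0 U.
  move=> oU; apply: inner_sup_dirac => // A oA _.
  - exact: le1.
  - by move=> /(b _ oA)[].
  - by move=> /(a _ oA)[].
have d'' U : open U -> inner_sup (nu'' f) U = \d_x0 U.
  move=> oU; apply: inner_sup_dirac => // A oA _.
  - exact: le_trans (nu''_le_nu' _ _) (le1 _ oA).
  - by move=> /(b _ oA)[].
  - by move=> /(a _ oA)[].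
split; first by move=> k; exact: (Linfty_bumps sw Kco wK).
split.
  apply: (weakly_null_bumps sw Kco Bdisj wK w2 oO) => k.
  by apply: subset_trans U0O; exact: BU0.
split; first by move=> U oU _; exact: a.
split; first by move=> U oU _; exact: b.
split=> //; split.
  apply: (@rich_off_point _ _ _ _ x0) => [U []//|U oU UO Ux|U oU UO Ux]; split=> //.
    by have [-> ->] := b _ oU Ux.
  by have [-> ->] := a _ oU Ux.
split; first by move=> U oU _; rewrite d' ?d''.
split; first by move=> U oU _; exact: d'.
split.
  by rewrite d'// diracE memNset.
by have [-> ->] := c1; rewrite lte01.
Qed.
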